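(* Let $f\in\{x,y,z\}$ and define the main term $\mathcal{M}_{\mathfrak{q}}=\sum_{q\mid\mathfrak{q},\,q<Q_0}\rho(\mathfrak{q}/q)\sum_{\gamma\in\Gamma}\Upsilon_X(\gamma)\sum_{\omega\in\Omega_Y}\Xi(q;f(x_0\cdot\gamma\omega))$. Then for admissible $\mathfrak{q}$ one can write $\mathcal{M}_{\mathfrak{q}}=\beta_f(\mathfrak{q})\chi+r^{(1)}(\mathfrak{q})+r^{(2)}(\mathfrak{q})$ where, for every $\epsilon>0$ and $\mathcal{Q}\ge 1$, $$\sum_{\mathfrak{q}<\mathcal{Q}}|r^{(1)}(\mathfrak{q})|\ll_\epsilon \frac{\chi\,\mathcal{Q}^\epsilon Q_0}{X^{2(\delta-\theta)}},\qquad \sum_{\mathfrak{q}<\mathcal{Q}}|r^{(2)}(\mathfrak{q})|\ll_\epsilon \frac{\chi\,\mathcal{Q}^\epsilon}{Q_0},$$ the sums running over admissible $\mathfrak{q}$.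
   Context: Standing setup: $\Gamma\le SL(2,\mathbb{Z})$ is finitely generated, Zariski dense in $SL_2$, thin, without parabolic elements, with critical exponent $\delta>1/2$ and spectral gap parameter $\theta<\delta$. $\mathcal{B}$ is the bad modulus (for squarefree $q$ coprime to $\mathcal{B}$ the reduction $\Gamma\to SL(2,\mathbb{Z}/q\mathbb{Z})$ is surjective), $2\mid\mathcal{B}$. Admissible moduli: squarefree $\mathfrak{q}$ coprime to $\mathcal{B}$, and when $f=z$ all prime factors $\equiv1\pmod 4$. $x_0=(0,1)$, $\Gamma$ acts on row vectors on the right; $x(c,d)=d^2-c^2$, $y(c,d)=2cd$, $z(c,d)=c^2+d^2$. $\|\gamma\|^2$ is the sum of squares of the entries. $X=T^x$, $Y=T^y$ with $x+y=1$, $Q_0$ a small positive power of $T$, $\Omega_Y=\{\omega\in\Gamma:\|\omega\|<Y\}$. $\Upsilon_X:\Gamma\to[0,1]$ is a smoothed indicator equal to $1$ for $\|\gamma\|<\frac9{10}X$ and $0$ for $\|\gamma\|>\frac{11}{10}X$, with $\sum_\Gamma\Upsilon_X\sim CX^{2\delta}$ and, for every $\gamma_0\in\Gamma$, squarefree $q$ coprime to $\mathcal{B}$ and $\Gamma(q)\le\tilde\Gamma\le\Gamma$, $\sum_{\gamma\in\tilde\Gamma}\Upsilon_X(\gamma\gamma_0)=[\Gamma:\tilde\Gamma]^{-1}\sum_{\gamma\in\Gamma}\Upsilon_X(\gamma)+O(X^{2\theta})$ uniformly. $\chi=|\Omega_Y|\sum_{\gamma\in\Gamma}\Upsilon_X(\gamma)$.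 $\rho$ is multiplicative, supported on squarefree integers, $\rho(p)=\frac{2p-1}{p^2}$; $\Xi(q;n)=\prod_{p\mid q}(1_{\{n\equiv0\,(p)\}}-\rho(p))$ for squarefree $q$. $\beta_f$ is multiplicative on squarefree integers with $\beta_f(p)=\frac{2}{p+1}$ if $(p,\mathcal{B})=1$ and either $f\in\{x,y\}$ or ($f=z$ and $p\equiv1\pmod4$), and $\beta_f(p)=0$ otherwise. *)

(* Defs.v *)
From Stdlib Require Import Bool Reals ZArith Znumtheory List Lia.
Open Scope R_scope.

Record mat := Mat { ma : Z; mb : Z; mc : Z; md : Z }.

Definition mmul (g h : mat) : mat :=
  Mat (ma g * ma h + mb g * mc h)%Z (ma g * mb h + mb g * md h)%Z
      (mc g * ma h + md g * mc h)%Z (mc g * mb h + md g * md h)%Z.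
Definition mdet (g : mat) : Z := (ma g * md g - mb g * mc g)%Z.
Definition mtr (g : mat) : Z := (ma g + md g)%Z.
Definition mI : mat := Mat 1 0 0 1.
Definition mnegI : mat := Mat (-1) 0 0 (-1).
(* inverse of a determinant-one matrix (adjugate) *)
Definition minv (g : mat) : mat := Mat (md g) (- mb g)%Z (- mc g)%Z (ma g).
Definition norm2 (g : mat) : Z := (ma g ^ 2 + mb g ^ 2 + mc g ^ 2 + md g ^ 2)%Z.
Definition mnorm (g : mat) : R := sqrt (IZR (norm2 g)).
Definition mcong (g h : mat) (q : Z) : Prop :=
  (ma g mod q = ma h mod q /\ mb g mod q = mb h mod q /\
   mc g mod q = mc h mod q /\ md g mod q = md h mod q)%Z.

Definition is_subgroup (G : mat -> bool) : Prop :=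
  G mI = true /\ (forall g h, G g = true -> G h = true -> G (mmul g h) = true)
  /\ (forall g, G g = true -> G (minv g) = true).

Definition in_SL2Z (G : mat -> bool) : Prop := forall g, G g = true -> mdet g = 1%Z.

Inductive generated (gens : list mat) : mat -> Prop :=
| gen_I : generated gens mI
| gen_mul : forall s g, In s gens -> generated gens g -> generated gens (mmul s g)
| gen_mulinv : forall s g, In s gens -> generated gens g -> generated gens (mmul (minv s) g).

Definition fin_generated (G : mat -> bool) : Prop :=
  exists gens : list mat, forall g, G g = true <-> generated gens g.

Definition poly4 := list (Z * (nat * nat * nat * nat)).
Definition peval (P : poly4) (g : mat) : Z :=
  fold_right (fun t acc => match t with (c, (i, j, k, l)) =>
     (c * ma g ^ Z.of_nat i * mb g ^ Z.of_nat j * mc g ^ Z.of_nat k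
        * md g ^ Z.of_nat l + acc)%Z end) 0%Z P.
(* Zariski density in SL_2: every (rational) polynomial vanishing on G vanishes
   on SL(2,Z), which is Zariski dense in SL_2 (closure of G is defined over Q). *)
Definition zariski_dense (G : mat -> bool) : Prop :=
  forall P : poly4, (forall g, G g = true -> peval P g = 0%Z) ->
    forall g, mdet g = 1%Z -> peval P g = 0%Z.

Definition infinite_index (G : mat -> bool) : Prop :=
  ~ exists reps : list mat, forall g, mdet g = 1%Z ->
      exists r, In r reps /\ G (mmul g (minv r)) = true.

Definition no_parabolic (G : mat -> bool) : Prop :=
  forall g, G g = true -> (mtr g = 2%Z \/ mtr g = (-2)%Z) -> g = mI \/ g = mnegI.

Definition Zrange (B : Z) : list Z :=
  map (fun i => (Z.of_nat i - B)%Z) (seq 0 (Z.to_nat (2 * B + 1))).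
Definition boxlist (B : Z) : list mat :=
  flat_map (fun a => flat_map (fun b => flat_map (fun c =>
     map (fun d => Mat a b c d) (Zrange B)) (Zrange B)) (Zrange B)) (Zrange B).
Definition boxsum (G : mat -> bool) (F : mat -> R) (B : Z) : R :=
  fold_right Rplus 0 (map (fun g => if G g then F g else 0) (boxlist B)).
Definition ballsum (G : mat -> bool) (F : mat -> R) (R0 : R) : R :=
  boxsum G F (up R0).

Definition poincare_conv (G : mat -> bool) (s : R) : Prop :=
  exists M, forall B : nat,
    boxsum G (fun g => Rpower (IZR (norm2 g)) (- s)) (Z.of_nat B) <= M.
Definition critical_exponent (G : mat -> bool) (delta : R) : Prop :=
  (forall s, s > delta -> poincare_conv G s) /\
  (forall s, s < delta -> ~ poincare_conv G s).

Definition primeb (p : Z) : bool := if prime_dec p then true else false.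
Definition pfactors (q : Z) : list Z :=
  filter (fun p => primeb p && Z.eqb (q mod p) 0)
         (map Z.of_nat (seq 0 (Z.to_nat q + 1))).
Definition prodp (q : Z) (F : Z -> R) : R := fold_right Rmult 1 (map F (pfactors q)).
Definition sqfreeb (q : Z) : bool :=
  Z.ltb 0 q && forallb (fun p => negb (Z.eqb (q mod (p * p)) 0)) (pfactors q).

Definition rho_p (p : Z) : R := (2 * IZR p - 1) / (IZR p ^ 2).
Definition rho (m : Z) : R := if sqfreeb m then prodp m rho_p else 0.
Definition Xi (q n : Z) : R :=
  prodp q (fun p => (if Z.eqb (n mod p) 0 then 1 else 0) - rho_p p).

Inductive form := fx | fy | fz.
Definition feval (f : form) (c d : Z) : Z :=
  match f with
  | fx => (d ^ 2 - c ^ 2)%Z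
  | fy => (2 * c * d)%Z
  | fz => (c ^ 2 + d ^ 2)%Z
  end.
(* f(x0 . g) with x0 = (0,1) a row vector acting on the right: x0.g = (c,d) *)
Definition f_x0 (f : form) (g : mat) : Z := feval f (mc g) (md g).

Definition good_prime (f : form) (Bad p : Z) : bool :=
  Z.eqb (Z.gcd p Bad) 1 &&
  match f with fz => Z.eqb (p mod 4) 1 | _ => true end.
Definition beta (f : form) (Bad q : Z) : R :=
  prodp q (fun p => if good_prime f Bad p then 2 / (IZR p + 1) else 0).

Definition admissible (f : form) (Bad q : Z) : bool :=
  sqfreeb q && Z.eqb (Z.gcd q Bad) 1 &&
  match f with fz => forallb (fun p => Z.eqb (p mod 4) 1) (pfactors q) | _ => true end.

Definition is_index (G H : mat -> bool) (n : nat) : Prop :=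
  exists reps : list mat, length reps = n /\ (forall r, In r reps -> G r = true) /\
    forall g, G g = true -> length (filter (fun r => H (mmul g (minv r))) reps) = 1%nat.

Definition Rltb (a b : R) : bool := if Rlt_dec a b then true else false.
Definition Omega (G : mat -> bool) (Y : R) : mat -> bool :=
  fun w => G w && Rltb (mnorm w) Y.
Definition OmegaCard (G : mat -> bool) (Y : R) : R := ballsum (Omega G Y) (fun _ => 1) Y.
(* sum over gamma in G of Ups X gamma: Ups X vanishes for ||gamma|| > 11X/10,
   and every entry is <= ||gamma||, so the box of size 2X contains the support *)
Definition UpsSum (G : mat -> bool) (Ups : R -> mat -> R) (X : R) : R :=
  ballsum G (Ups X) (2 * X).
Definition chi (G : mat -> bool) (Ups : R -> mat -> R) (X Y : R) : R :=
  OmegaCard G Y * UpsSum G Ups X.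
Definition innerS (G : mat -> bool) (Ups : R -> mat -> R) (f : form) (q : Z) (X Y : R) : R :=
  ballsum G (fun g => Ups X g *
     ballsum (Omega G Y) (fun w => Xi q (f_x0 f (mmul g w))) Y) (2 * X).
Definition mainM (G : mat -> bool) (Ups : R -> mat -> R) (f : form) (X Y Q0 : R) (qq : Z) : R :=
  fold_right Rplus 0
    (map (fun q => if Z.eqb (qq mod q) 0 && Rltb (IZR q) Q0
                   then rho (qq / q) * innerS G Ups f q X Y else 0)
         (map Z.of_nat (seq 1 (Z.to_nat qq)))).
Definition adm_sum (f : form) (Bad : Z) (QQ : R) (F : Z -> R) : R :=
  fold_right Rplus 0
    (map (fun qq => if admissible f Bad qq && Rltb (IZR qq) QQ then F qq else 0)
         (map Z.of_nat (seq 1 (Z.to_nat (up QQ))))).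

(* Main.v *)
(* Write 1(p | n) - rho(p) factor by factor. For a prime p the condition p | f(c, d) says that (c : d)
   is one of two points of the projective line over Z/p, so for squarefree q the condition
   q | f(x_0 g w) cuts Gamma into 2^omega(q) cosets of the subgroup {q | lower left entry}, whose
   index is the product of the p + 1. Equidistribution of Ups on these cosets gives, for each w,
   the value (sum of Ups) * prod (2/(p+1) - rho(p)) for the sum of Ups * Xi(q; .), with error
   O(3^omega(q) X^(2 theta)). Then r1 collects these errors, and r2 is minus chi times the part
   q >= Q_0 of the convolution of rho with prod (2/(p+1) - rho(p)), which over all q | qq sums to
   beta(qq); it is small because |2/(p+1) - rho(p)| <= 1/p^2. *)
Require Import Defs.
From Stdlib Require Import Bool Reals ZArith Znumtheory List.
From Stdlib Require Import Lia Lra Permutation.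
Open Scope R_scope.

(** Equidistribution is available only for cosets of a subgroup whose index is witnessed by a list
    of representatives, so each divisibility condition has to become membership in such cosets.
    Lines modulo q are therefore represented by matrices of determinant 1 modulo q: surjectivity of
    the reduction lifts these to Gamma, once to obtain coset representatives for the index, once to
    obtain the shifts of the cosets. The base 3 is 2 + 1: opening the factor at p gives two lines
    plus one term of weight rho(p) <= 1. The error X^(2 theta) turns into (sum of Ups) / X^(2(delta
    - theta)) through the asymptotics of the sum of Ups. These hold only for large X, while the
    constants must be uniform in T >= 1, so bounded X need a separate trivial estimate. For both
    remainders the sum over qq is majorised by a sum over q times the sum of rho(m), the latter
    being O(Q^eps). In the first bound Q0 is just the number of q < Q0, and the powers 3^omega(q)
    cost a further Q^eps; in the second, 1/Q0 is the tail of the sum of 1/q^2. *)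

(** * Finite sums and products over lists *)

Definition lsum {A} (l : list A) (F : A -> R) : R := fold_right Rplus 0 (map F l).
Definition lprod {A} (l : list A) (F : A -> R) : R := fold_right Rmult 1 (map F l).
Definition ind (b : bool) : R := if b then 1 else 0.

Lemma lsum_cons {A} (a : A) l F : lsum (a :: l) F = F a + lsum l F.
Proof. reflexivity. Qed.

Lemma lprod_cons {A} (a : A) l F : lprod (a :: l) F = F a * lprod l F.
Proof. reflexivity. Qed.

Lemma lsum_ext {A} (l : list A) F F' :
  (forall a, In a l -> F a = F' a) -> lsum l F = lsum l F'.
Proof. intros H; unfold lsum; f_equal; now apply map_ext_in. Qed.

Lemma lprod_ext {A} (l : list A) F F' :
  (forall a, In a l -> F a = F' a) -> lprod l F = lprod l F'.
Proof. intros H; unfold lprod; f_equal; now apply map_ext_in. Qed.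

Lemma lsum_plus {A} (l : list A) F F' :
  lsum l (fun a => F a + F' a) = lsum l F + lsum l F'.
Proof. induction l; rewrite ?lsum_cons; [unfold lsum; simpl; ring|]. rewrite IHl; ring. Qed.

Lemma lsum_scal {A} (l : list A) c F : lsum l (fun a => c * F a) = c * lsum l F.
Proof. induction l; rewrite ?lsum_cons; [unfold lsum; simpl; ring|]. rewrite IHl; ring. Qed.

Lemma lsum_minus {A} (l : list A) F F' :
  lsum l (fun a => F a - F' a) = lsum l F - lsum l F'.
Proof. induction l; rewrite ?lsum_cons; [unfold lsum; simpl; ring|]. rewrite IHl; ring. Qed.

Lemma lsum_const {A} (l : list A) c : lsum l (fun _ => c) = INR (length l) * c.
Proof.
  induction l; rewrite ?lsum_cons; [unfold lsum; simpl; ring|].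
  rewrite IHl; cbn [length]; rewrite S_INR; ring.
Qed.

Lemma lsum_swap {A B} (l : list A) (l' : list B) F :
  lsum l (fun a => lsum l' (F a)) = lsum l' (fun b => lsum l (fun a => F a b)).
Proof.
  induction l.
  - symmetry. transitivity (lsum l' (fun _ => 0)); [reflexivity|].
    rewrite lsum_const. unfold lsum; simpl; ring.
  - rewrite lsum_cons, IHl, <- lsum_plus. now apply lsum_ext.
Qed.

Lemma lsum_app {A} (l l' : list A) F : lsum (l ++ l') F = lsum l F + lsum l' F.
Proof.
  induction l; [unfold lsum; simpl; ring|].
  cbn [app]; rewrite !lsum_cons, IHl; ring.
Qed.

Lemma lsum_map {A B} (h : A -> B) l F : lsum (map h l) F = lsum l (fun a => F (h a)).
Proof. unfold lsum; now rewrite map_map. Qed.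

Lemma lsum_flat_map {A B} (h : A -> list B) l F :
  lsum (flat_map h l) F = lsum l (fun a => lsum (h a) F).
Proof.
  induction l; [reflexivity|]. cbn [flat_map]. now rewrite lsum_app, lsum_cons, IHl.
Qed.

Lemma lsum_filter {A} (P : A -> bool) l F :
  lsum (filter P l) F = lsum l (fun a => if P a then F a else 0).
Proof.
  induction l; [reflexivity|]. cbn [filter]. rewrite lsum_cons, <- IHl.
  destruct (P a); rewrite ?lsum_cons; ring.
Qed.

Lemma lsum_ind_length {A} (P : A -> bool) l :
  lsum l (fun a => ind (P a)) = INR (length (filter P l)).
Proof.
  rewrite <- (Rmult_1_r (INR _)), <- lsum_const, lsum_filter. reflexivity.
Qed.

Lemma lsum_perm {A} (l l' : list A) F : Permutation l l' -> lsum l F = lsum l' F.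
Proof. induction 1; rewrite ?lsum_cons in *; try lra; reflexivity. Qed.

Lemma lprod_perm {A} (l l' : list A) F : Permutation l l' -> lprod l F = lprod l' F.
Proof.
  induction 1; rewrite ?lprod_cons; [reflexivity|now rewrite IHPermutation|ring|congruence].
Qed.

Lemma lsum_le {A} (l : list A) F F' :
  (forall a, In a l -> F a <= F' a) -> lsum l F <= lsum l F'.
Proof.
  induction l; intros H; [unfold lsum; simpl; lra|]. rewrite !lsum_cons.
  apply Rplus_le_compat; [now apply H; left|apply IHl; intros; apply H; now right].
Qed.

Lemma lsum_nonneg {A} (l : list A) F : (forall a, In a l -> 0 <= F a) -> 0 <= lsum l F.
Proof.
  intros H. apply Rle_trans with (lsum l (fun _ => 0)); [|now apply lsum_le].
  rewrite lsum_const; lra.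
Qed.

Lemma lsum_abs {A} (l : list A) F : Rabs (lsum l F) <= lsum l (fun a => Rabs (F a)).
Proof.
  induction l; [unfold lsum; simpl; rewrite Rabs_R0; lra|]. rewrite !lsum_cons.
  eapply Rle_trans; [apply Rabs_triang|]. lra.
Qed.

Lemma lprod_mult {A} (l : list A) F F' :
  lprod l (fun a => F a * F' a) = lprod l F * lprod l F'.
Proof. induction l; [unfold lprod; simpl; ring|]. rewrite !lprod_cons, IHl; ring. Qed.

Lemma lprod_const {A} (l : list A) c : lprod l (fun _ => c) = c ^ length l.
Proof. induction l; [reflexivity|]. rewrite lprod_cons, IHl; reflexivity. Qed.

Lemma lprod_nonneg {A} (l : list A) F : (forall a, In a l -> 0 <= F a) -> 0 <= lprod l F.
Proof.
  induction l; intros H; [unfold lprod; simpl; lra|]. rewrite lprod_cons.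
  apply Rmult_le_pos; [now apply H; left|apply IHl; intros; apply H; now right].
Qed.

Lemma lprod_le {A} (l : list A) F F' :
  (forall a, In a l -> 0 <= F a <= F' a) -> lprod l F <= lprod l F'.
Proof.
  induction l; intros H; [unfold lprod; simpl; lra|]. rewrite !lprod_cons.
  apply Rmult_le_compat; try (apply H; now left).
  - apply lprod_nonneg; intros; apply H; now right.
  - apply IHl; intros; apply H; now right.
Qed.

Lemma lprod_abs {A} (l : list A) F : Rabs (lprod l F) = lprod l (fun a => Rabs (F a)).
Proof.
  induction l; [unfold lprod; simpl; apply Rabs_R1|]. now rewrite !lprod_cons, Rabs_mult, IHl.
Qed.

Lemma lprod_abs_le1 {A} (l : list A) F :
  (forall a, In a l -> Rabs (F a) <= 1) -> Rabs (lprod l F) <= 1.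
Proof.
  intros H. rewrite lprod_abs, <- (pow1 (length l)), <- lprod_const.
  apply lprod_le; intros a Ha; split; [apply Rabs_pos|now apply H].
Qed.

Lemma lprod_inv {A} (l : list A) F : lprod l (fun a => / F a) = / lprod l F.
Proof.
  induction l; [unfold lprod; simpl; now rewrite Rinv_1|].
  now rewrite !lprod_cons, IHl, Rinv_mult.
Qed.

(** * Squarefree integers *)

Definition dvdb (q n : Z) : bool := Z.eqb (n mod q) 0.

Lemma dvdb_iff q n : (0 < q)%Z -> dvdb q n = true <-> (q | n)%Z.
Proof. intros Hq. unfold dvdb. rewrite Z.eqb_eq. apply Z.mod_divide; lia. Qed.

Lemma primeb_iff p : primeb p = true <-> prime p.
Proof. unfold primeb; destruct (prime_dec p); split; easy. Qed.

Lemma two_le_prime p : prime p -> (2 <= p)%Z.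
Proof. intros [H _]; lia. Qed.

Lemma in_pfactors q p : (0 < q)%Z -> In p (pfactors q) <-> prime p /\ (p | q)%Z.
Proof.
  intros Hq. unfold pfactors. rewrite filter_In, andb_true_iff, primeb_iff, in_map_iff.
  split.
  - intros [_ [Hp Hd]]. split; [easy|]. apply two_le_prime in Hp. apply dvdb_iff; [lia|easy].
  - intros [Hp Hd]. pose proof (two_le_prime p Hp). pose proof (Z.divide_pos_le p q Hq Hd).
    split; [|split; [easy|apply dvdb_iff; [lia|easy]]].
    exists (Z.to_nat p). rewrite in_seq. lia.
Qed.

Lemma NoDup_pfactors q : NoDup (pfactors q).
Proof.
  apply NoDup_filter, FinFun.Injective_map_NoDup; [intros a b; lia|apply seq_NoDup].
Qed.

Lemma prodp_lprod q F : prodp q F = lprod (pfactors q) F.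
Proof. reflexivity. Qed.

Lemma sqfreeb_iff q :
  sqfreeb q = true <-> (0 < q)%Z /\ forall p, prime p -> ~ (p * p | q)%Z.
Proof.
  unfold sqfreeb. rewrite andb_true_iff, Z.ltb_lt, forallb_forall.
  split; intros [Hq H]; split; try easy.
  - intros p Hp Hd. pose proof (two_le_prime p Hp).
    assert (Hin : In p (pfactors q)).
    { apply in_pfactors; [easy|split; [easy|]]. eapply Z.divide_trans; [|exact Hd]. now exists p. }
    specialize (H p Hin). apply negb_true_iff in H.
    apply (dvdb_iff (p * p)) in Hd; [|nia]. unfold dvdb in Hd. congruence.
  - intros p Hp. apply in_pfactors in Hp; [|easy]. destruct Hp as [Hp _].
    apply negb_true_iff, not_true_iff_false. intros Hd.
    pose proof (two_le_prime p Hp). apply (H p Hp), dvdb_iff; [nia|easy].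
Qed.

Lemma sqfreeb_pos q : sqfreeb q = true -> (0 < q)%Z.
Proof. now rewrite sqfreeb_iff. Qed.

Lemma sqfreeb_divide q d :
  sqfreeb q = true -> (0 < d)%Z -> (d | q)%Z -> sqfreeb d = true.
Proof.
  rewrite !sqfreeb_iff. intros [_ H] Hd Hdq. split; [easy|].
  intros p Hp Hpd. apply (H p Hp). now apply Z.divide_trans with d.
Qed.

Lemma pfactors_1 : pfactors 1 = nil.
Proof. 
  destruct (pfactors 1) as [|p l] eqn:E; [easy|].
  assert (In p (pfactors 1)) as H by (rewrite E; now left).
  apply in_pfactors in H; [|lia]. destruct H as [Hp Hd].
  apply two_le_prime in Hp. apply Z.divide_1_r_nonneg in Hd; lia.
Qed.

Lemma pfactors_mul p q :
  prime p -> (0 < q)%Z -> ~ (p | q)%Z -> Permutation (pfactors (p * q)) (p :: pfactors q).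
Proof.
  intros Hp Hq Hpq. pose proof (two_le_prime p Hp).
  apply NoDup_Permutation.
  - apply NoDup_pfactors.
  - constructor; [|apply NoDup_pfactors]. now rewrite in_pfactors.
  - intros r. cbn [In]. rewrite !in_pfactors by nia. split.
    + intros [Hr Hd]. destruct (prime_mult r Hr _ _ Hd) as [H1|H1]; [left|now right].
      symmetry; now apply prime_div_prime.
    + intros [->|[Hr Hd]].
      * split; [easy|apply Z.divide_factor_l].
      * split; [easy|now apply Z.divide_mul_r].
Qed.

Lemma prodp_mul p q F :
  prime p -> (0 < q)%Z -> ~ (p | q)%Z -> prodp (p * q) F = F p * prodp q F.
Proof.
  intros Hp Hq Hpq. rewrite !prodp_lprod.
  now rewrite (lprod_perm _ _ F (pfactors_mul p q Hp Hq Hpq)).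
Qed.

Lemma exists_prime_divisor q : (1 < q)%Z -> exists p, prime p /\ (p | q)%Z.
Proof.
  intros Hq. assert (H0 : (0 <= q)%Z) by lia. revert Hq.
  pattern q; apply Z_lt_induction; [clear|easy]. intros q IH Hq.
  destruct (prime_dec q) as [H|H]; [exists q; split; [easy|apply Z.divide_refl]|].
  destruct (not_prime_divide q Hq H) as [d [Hd Hdq]].
  destruct (IH d) as [p [Hp Hpd]]; try lia.
  exists p; split; [easy|]. now apply Z.divide_trans with d.
Qed.

(** Strip off a prime divisor: squarefreeness keeps it from dividing the cofactor. Multiplicative
    identities thereby reduce to one step from q to p q. *)
Lemma sqfreeb_ind (P : Z -> Prop) :
  P 1%Z ->
  (forall p q, prime p -> ~ (p | q)%Z -> sqfreeb q = true -> P q -> P (p * q)%Z) ->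
  forall q, sqfreeb q = true -> P q.
Proof.
  intros H1 Hstep q Hq. pose proof (sqfreeb_pos q Hq) as Hpos.
  assert (H0 : (0 <= q)%Z) by lia. revert Hpos Hq.
  pattern q; apply Z_lt_induction; [clear q H0|easy]. intros q IH Hpos Hq.
  destruct (Z.eq_dec q 1) as [->|Hne]; [easy|].
  destruct (exists_prime_divisor q) as [p [Hp [r Hr]]]; [lia|]. subst q.
  pose proof (two_le_prime p Hp).
  assert (Hsq : sqfreeb r = true).
  { apply (sqfreeb_divide _ _ Hq); [nia|apply Z.divide_factor_l]. }
  rewrite Z.mul_comm. apply Hstep; try easy.
  - intros [s ->]. apply sqfreeb_iff in Hq. destruct Hq as [_ Hq].
    apply (Hq p Hp). exists s; ring.
  - apply IH; try easy; nia.
Qed.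

Lemma prodp_1 F : prodp 1 F = 1.
Proof. rewrite prodp_lprod, pfactors_1. reflexivity. Qed.

Lemma prodp_IZR q : sqfreeb q = true -> prodp q IZR = IZR q.
Proof.
  revert q; apply sqfreeb_ind; [apply prodp_1|]. intros p q Hp Hpq Hq IH.
  rewrite prodp_mul, IH, mult_IZR; [easy|easy|now apply sqfreeb_pos|easy].
Qed.

(** Convertible to the ranges of summation in [mainM] and [adm_sum], so those sums become [lsum]s
    without rewriting. *)
Definition rng (n : nat) : list Z := map Z.of_nat (seq 1 n).

Lemma in_rng n d : In d (rng n) <-> (1 <= d <= Z.of_nat n)%Z.
Proof.
  unfold rng. rewrite in_map_iff. split.
  - intros [k [<- Hk]]. apply in_seq in Hk. lia.
  - intros Hd. exists (Z.to_nat d). rewrite in_seq. lia.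
Qed.

Lemma NoDup_rng n : NoDup (rng n).
Proof. apply FinFun.Injective_map_NoDup; [intros a b; lia|apply seq_NoDup]. Qed.

Lemma rng_S n : rng (S n) = rng n ++ (Z.of_nat (S n) :: nil).
Proof. unfold rng. rewrite seq_S, map_app. reflexivity. Qed.

Definition divs (q : Z) : list Z := filter (fun d => dvdb d q) (rng (Z.to_nat q)).

Lemma in_divs q d : (0 < q)%Z -> In d (divs q) <-> (0 < d)%Z /\ (d | q)%Z.
Proof.
  intros Hq. unfold divs. rewrite filter_In, in_rng. split.
  - intros [Hd Hdq]. apply dvdb_iff in Hdq; [split; [lia|easy]|lia].
  - intros [Hd Hdq]. rewrite dvdb_iff by easy. split; [|easy].
    apply Z.divide_pos_le in Hdq; lia.
Qed.

Lemma NoDup_divs q : NoDup (divs q).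
Proof. apply NoDup_filter, NoDup_rng. Qed.

Lemma divs_mul p q : prime p -> (0 < q)%Z -> ~ (p | q)%Z ->
  Permutation (divs (p * q)) (divs q ++ map (Z.mul p) (divs q)).
Proof.
  intros Hp Hq Hpq. pose proof (two_le_prime p Hp).
  apply NoDup_Permutation.
  - apply NoDup_divs.
  - apply NoDup_app.
    + apply NoDup_divs.
    + apply FinFun.Injective_map_NoDup; [intros a b; nia|apply NoDup_divs].
    + intros d Hd Hd'. apply in_map_iff in Hd'. destruct Hd' as [e [<- _]].
      apply in_divs in Hd; [|easy]. destruct Hd as [_ Hd]. apply Hpq.
      apply Z.divide_trans with (p * e)%Z; [apply Z.divide_factor_l|easy].
  - intros d. rewrite in_app_iff, in_map_iff, !in_divs by nia. split.
    + intros [Hd Hdq]. destruct (Zdivide_dec p d) as [[e ->]|Hn].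
      * right. exists e. split; [ring|]. apply in_divs; [easy|]. split; [nia|].
        apply (Z.mul_divide_cancel_l _ _ p); [lia|]. now rewrite (Z.mul_comm p e).
      * left. split; [easy|]. apply Gauss with p; [easy|].
        apply rel_prime_sym, prime_rel_prime; easy.
    + intros [[Hd Hdq]|[e [<- He]]].
      * split; [easy|now apply Z.divide_mul_r].
      * apply in_divs in He; [|easy]. split; [nia|].
        apply Z.mul_divide_mono_l; easy.
Qed.

(** Expanding the product selects g or h at each prime; the divisor d collects the primes where h is
    selected. *)
Lemma sum_divisors_prodp q g h : sqfreeb q = true ->
  lsum (divs q) (fun d => prodp (q / d) g * prodp d h) = prodp q (fun p => g p + h p).
Proof.
  revert q; apply sqfreeb_ind.
  - rewrite prodp_1. change (divs 1) with (1%Z :: nil).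
    rewrite lsum_cons, Z.div_1_r, !prodp_1. unfold lsum; simpl; ring.
  - intros p q Hp Hpq Hq IH. pose proof (sqfreeb_pos q Hq) as Hpos.
    pose proof (two_le_prime p Hp).
    rewrite (lsum_perm _ _ _ (divs_mul p q Hp Hpos Hpq)), lsum_app, lsum_map, prodp_mul by easy.
    rewrite <- IH, Rmult_plus_distr_r, <- !lsum_scal. f_equal; apply lsum_ext; intros d Hd;
      apply in_divs in Hd; try easy; destruct Hd as [Hd [e ->]].
    + rewrite Z.mul_assoc, !Z.div_mul, prodp_mul; try lia; try nia; try easy; [ring|].
      intros H'; apply Hpq; now apply Z.divide_mul_l.
    + rewrite Z.div_mul_cancel_l, prodp_mul; try lia; try easy; [ring|].
      intros H'; apply Hpq; now apply Z.divide_mul_r.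
Qed.

Lemma rho_prodp m : sqfreeb m = true -> rho m = prodp m rho_p.
Proof. intros H; unfold rho; now rewrite H. Qed.

(** * Lines modulo q *)

(** From here on a squarefree modulus is carried as its list of primes, so that arguments prime by
    prime are inductions on lists. *)
Definition zprod (ps : list Z) : Z := fold_right Z.mul 1%Z ps.

Lemma zprod_pos ps : (forall p, In p ps -> prime p) -> (0 < zprod ps)%Z.
Proof.
  induction ps as [|p ps IH]; intros H; [easy|]. cbn.
  apply Z.mul_pos_pos; [apply Z.lt_le_trans with 2%Z; [lia|apply two_le_prime, H; now left]|].
  apply IH; intros; apply H; now right.
Qed.

Lemma prime_divide_zprod ps p :
  (forall p, In p ps -> prime p) -> prime p -> (p | zprod ps)%Z -> In p ps.
Proof.
  intros H Hp; induction ps as [|r ps IH]; cbn; intros Hd.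
  - apply two_le_prime in Hp. apply Z.divide_1_r_nonneg in Hd; lia.
  - destruct (prime_mult p Hp _ _ Hd) as [H1|H1].
    + left. symmetry. apply prime_div_prime; try easy. apply H; now left.
    + right. apply IH; [intros; apply H; now right|easy].
Qed.

Lemma sqfreeb_zprod ps :
  NoDup ps -> (forall p, In p ps -> prime p) -> sqfreeb (zprod ps) = true.
Proof.
  intros Hnd H. apply sqfreeb_iff. split; [now apply zprod_pos|]. intros p Hp.
  induction Hnd as [|r ps Hr Hnd IH]; cbn; intros Hd.
  - apply two_le_prime in Hp. apply Z.divide_1_r_nonneg in Hd; nia.
  - assert (H' : forall p, In p ps -> prime p) by (intros; apply H; now right).
    destruct (Z.eq_dec p r) as [->|Hne].
    + apply Hr, prime_divide_zprod; try easy.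
      apply (Z.mul_divide_cancel_l _ _ r); [apply two_le_prime in Hp; lia|easy].
    + apply IH; [easy|]. apply Gauss with r; [easy|].
      apply rel_prime_sym, rel_prime_mult; apply rel_prime_sym, prime_rel_prime; try easy;
        intros Hd'; apply Hne, prime_div_prime; try easy; apply H; now left.
Qed.

Lemma gcd_zprod ps B : (forall p, In p ps -> Z.gcd p B = 1%Z) -> Z.gcd (zprod ps) B = 1%Z.
Proof.
  induction ps as [|p ps IH]; intros H; cbn [zprod fold_right]; [apply Z.gcd_1_l|].
  apply Zgcd_1_rel_prime, rel_prime_sym, rel_prime_mult; apply rel_prime_sym, Zgcd_1_rel_prime.
  - apply H; now left.
  - apply IH; intros; apply H; now right.
Qed.

Lemma mul_divide_rel_prime a b n :
  rel_prime a b -> (a | n)%Z -> (b | n)%Z -> (a * b | n)%Z.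
Proof.
  intros Hab [k ->] Hb. rewrite (Z.mul_comm k). apply Z.mul_divide_mono_l.
  apply Gauss with a; [now rewrite Z.mul_comm|now apply rel_prime_sym].
Qed.

(* [(c, d)] lies on the line spanned by the bottom row of [m] iff this vanishes. *)
Definition cross (m : mat) (c d : Z) : Z := (c * md m - d * mc m)%Z.

(** Chinese remainder interpolation: when s is 1 modulo p and 0 modulo q, and t the reverse, the
    result is m modulo p and m' modulo q. *)
Definition glue (s t : Z) (m m' : mat) : mat :=
  Mat (s * ma m + t * ma m') (s * mb m + t * mb m')
      (s * mc m + t * mc m') (s * md m + t * md m').

Lemma ind_andb a b : ind (a && b) = ind a * ind b.
Proof. destruct a, b; cbn; ring. Qed.

(** A line modulo the product amounts to a line modulo each prime, so the number of lines and the
    count of those through a given point are both multiplicative. Gluing preserves determinant 1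
    only as a congruence, which is all that lifting to Gamma requires. *)
Lemma crt_lines ps (L : Z -> list mat) :
  NoDup ps -> (forall p, In p ps -> prime p) ->
  (forall p m, In p ps -> In m (L p) -> (p | mdet m - 1)%Z) ->
  exists M : list mat,
    INR (length M) = lprod ps (fun p => INR (length (L p))) /\
    (forall m, In m M -> (zprod ps | mdet m - 1)%Z) /\
    (forall c d, lsum M (fun m => ind (dvdb (zprod ps) (cross m c d))) =
       lprod ps (fun p => lsum (L p) (fun m => ind (dvdb p (cross m c d))))).
Proof.
  induction ps as [|p ps IH]; intros Hnd Hpr Hdet.
  - exists (mI :: nil). repeat split; try easy.
    + intros m _. apply Z.divide_1_l.
    + intros c d. unfold lsum, lprod, dvdb; cbn [map fold_right zprod].
      rewrite Z.mod_1_r. cbn. ring.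
  - apply NoDup_cons_iff in Hnd. destruct Hnd as [Hp Hnd].
    assert (Hpr' : forall p, In p ps -> prime p) by (intros; apply Hpr; now right).
    assert (Hpp : prime p) by (apply Hpr; now left).
    destruct IH as [M [Hlen [HM Hsum]]]; try easy.
    { intros; apply Hdet; [now right|easy]. }
    cbn [zprod fold_right]. fold (zprod ps). set (q := zprod ps) in *.
    assert (Hq : (0 < q)%Z) by now apply zprod_pos.
    pose proof (two_le_prime p Hpp).
    assert (Hrel : rel_prime p q).
    { apply prime_rel_prime; [easy|]. intros Hd. now apply Hp, prime_divide_zprod. }
    destruct (rel_prime_bezout _ _ Hrel) as [u v Huv].
    set (K := glue (v * q) (u * p)).
    (* Since u p + v q = 1, the combination v q x + u p y is x modulo p and y modulo q. *)
    assert (Hsplit : forall x y, (p | x)%Z /\ (q | y)%Z <->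
      (p * q | v * q * x + u * p * y)%Z).
    { intros x y. split.
      - intros [[i ->] [j ->]]. exists (v * i + u * j)%Z. ring.
      - intros Hd. split.
        + replace x with (v * q * x + u * p * y + p * (u * (x - y)))%Z
            by (transitivity ((u * p + v * q) * x)%Z; [ring|rewrite Huv; ring]).
          apply Z.divide_add_r; [|apply Z.divide_factor_l].
          eapply Z.divide_trans; [apply Z.divide_factor_l|exact Hd].
        + replace y with (v * q * x + u * p * y + q * (v * (y - x)))%Z
            by (transitivity ((u * p + v * q) * y)%Z; [ring|rewrite Huv; ring]).
          apply Z.divide_add_r; [|apply Z.divide_factor_l].
          eapply Z.divide_trans; [apply Z.divide_factor_r|exact Hd]. }
    exists (flat_map (fun m => map (K m) M) (L p)). split; [|split].
    + rewrite <- (Rmult_1_r (INR _)), <- lsum_const, lsum_flat_map, lprod_cons, <- Hlen.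
      rewrite <- lsum_const. apply lsum_ext. intros m _.
      rewrite lsum_map, lsum_const. ring.
    + intros k Hk. apply in_flat_map in Hk. destruct Hk as [m [Hm Hk]].
      apply in_map_iff in Hk. destruct Hk as [m' [<- Hm']].
      assert (Hd : (p | mdet m - 1)%Z) by (apply Hdet; [now left|easy]).
      specialize (HM m' Hm').
      apply mul_divide_rel_prime; [easy| |].
      (* With v q = 1 - u p the glued matrix is m + u p (m' - m); expanding its determinant around m
         leaves a multiple of p. The other case is symmetric. *)
      * assert (Hv : (v * q = 1 - u * p)%Z) by lia.
        replace (mdet (K m m') - 1)%Z with (mdet m - 1 + p *
           (u * (ma m * (md m' - md m) + md m * (ma m' - ma m) - mb m * (mc m' - mc m)
             - mc m * (mb m' - mb m) + p * u * ((ma m' - ma m) * (md m' - md m)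
             - (mb m' - mb m) * (mc m' - mc m)))))%Z
          by (unfold K; rewrite Hv; unfold glue, mdet; cbn [ma mb mc md]; ring).
        apply Z.divide_add_r; [easy|apply Z.divide_factor_l].
      * assert (Hu : (u * p = 1 - v * q)%Z) by lia.
        replace (mdet (K m m') - 1)%Z with (mdet m' - 1 + q *
           (v * (ma m' * (md m - md m') + md m' * (ma m - ma m') - mb m' * (mc m - mc m')
             - mc m' * (mb m - mb m') + q * v * ((ma m - ma m') * (md m - md m')
             - (mb m - mb m') * (mc m - mc m')))))%Z
          by (unfold K; rewrite Hu; unfold glue, mdet; cbn [ma mb mc md]; ring).
        apply Z.divide_add_r; [easy|apply Z.divide_factor_l].
    + intros c d. rewrite lprod_cons, <- Hsum, lsum_flat_map, Rmult_comm, <- lsum_scal.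
      apply lsum_ext. intros m _. rewrite lsum_map, Rmult_comm, <- lsum_scal.
      apply lsum_ext. intros m' _. rewrite <- ind_andb. f_equal.
      apply eq_true_iff_eq. rewrite andb_true_iff, !dvdb_iff by nia. rewrite Hsplit.
      replace (cross (K m m') c d) with (v * q * cross m c d + u * p * cross m' c d)%Z
        by (unfold K, glue, cross; cbn; ring). easy.
Qed.

Lemma mod_eq_divide a b q : (0 < q)%Z -> (a mod q = b mod q)%Z <-> (q | a - b)%Z.
Proof.
  intros Hq. rewrite <- Z.mod_divide by lia. split; intros H.
  - rewrite Zminus_mod, H, Z.sub_diag. apply Z.mod_0_l; lia.
  - apply Z.mod_divide in H; [|lia]. destruct H as [k Hk].
    replace a with (b + k * q)%Z by lia. apply Z.mod_add; lia.
Qed.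

Lemma dvdb_cong q a b : (0 < q)%Z -> (q | a - b)%Z -> dvdb q a = dvdb q b.
Proof. intros Hq H. unfold dvdb. now rewrite (proj2 (mod_eq_divide a b q Hq) H). Qed.

Lemma mcong_bottom g m q : (0 < q)%Z -> mcong g m q ->
  (q | mc g - mc m)%Z /\ (q | md g - md m)%Z.
Proof. intros Hq [_ [_ [Hc Hd]]]. now split; apply mod_eq_divide. Qed.

Lemma dvdb_cross_cong g m q c d : (0 < q)%Z ->
  (q | mc g - mc m)%Z -> (q | md g - md m)%Z ->
  dvdb q (cross g c d) = dvdb q (cross m c d).
Proof.
  intros Hq Hc Hd. apply dvdb_cong; [easy|]. unfold cross.
  replace (c * md g - d * mc g - (c * md m - d * mc m))%Z
    with (c * (md g - md m) - d * (mc g - mc m))%Z by ring.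
  apply Z.divide_sub_r; now apply Z.divide_mul_r.
Qed.

(** Choosing along a list keeps order and multiplicity, so lengths and counts carry over from the
    matrices to their lifts. *)
Lemma Forall2_choice {A B} (P : A -> B -> Prop) l :
  (forall a, In a l -> exists b, P a b) -> exists l', Forall2 P l l'.
Proof.
  induction l as [|a l IH]; intros H; [now exists nil|].
  destruct (H a) as [b Hb]; [now left|].
  destruct IH as [l' Hl']; [intros; apply H; now right|].
  exists (b :: l'). now constructor.
Qed.

(** * The stabilizer of a line modulo q and its index *)

(** The Hecke congruence condition inside G: the stabilizer of the line of (0, 1) modulo q under the
    right action, so its right cosets correspond to lines. *)
Definition gamma0 (G : mat -> bool) (q : Z) (g : mat) : bool := G g && dvdb q (mc g).

(** Translates coset membership into incidence: g and h lie in the same right coset of [gamma0]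
    exactly when the bottom row of g lies on the line of the bottom row of h modulo q. *)
Lemma mc_mul_minv g h : mc (mmul g (minv h)) = cross h (mc g) (md g).
Proof. unfold cross; cbn. ring. Qed.

Lemma gamma0_subgroup G q : (0 < q)%Z -> is_subgroup G -> is_subgroup (gamma0 G q).
Proof.
  intros Hq [H1 [H2 H3]]. unfold gamma0. split; [|split].
  - rewrite H1. apply dvdb_iff; [easy|apply Z.divide_0_r].
  - intros g h. rewrite !andb_true_iff, !dvdb_iff by easy. intros [Hg Hcg] [Hh Hch].
    split; [now apply H2|]. cbn. apply Z.divide_add_r; [now apply Z.divide_mul_l|now apply Z.divide_mul_r].
  - intros g. rewrite !andb_true_iff, !dvdb_iff by easy. intros [Hg Hcg].
    split; [now apply H3|]. cbn. now apply Z.divide_opp_r.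
Qed.

(* Bottom rows of these matrices represent the points of the projective line over Z/p. *)
Definition proj_line (p : Z) : list mat :=
  mI :: map (fun t => Mat 0 (-1) 1 (Z.of_nat t)) (seq 0 (Z.to_nat p)).

Lemma lsum_ind_single {A} (P : A -> bool) l a :
  NoDup l -> In a l -> P a = true -> (forall b, In b l -> P b = true -> b = a) ->
  lsum l (fun b => ind (P b)) = 1.
Proof.
  induction l as [|b l IH]; intros Hnd Ha HPa Hun; [easy|].
  apply NoDup_cons_iff in Hnd. destruct Hnd as [Hb Hnd]. rewrite lsum_cons.
  destruct Ha as [->|Ha].
  - rewrite HPa, (lsum_ext _ _ (fun _ => 0)); [rewrite lsum_const; cbn; ring|].
    intros c Hc. destruct (P c) eqn:E; [|easy]. exfalso. apply Hb.
    rewrite <- (Hun c); try easy. now right.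
  - rewrite IH; try easy; [|intros; apply Hun; [now right|easy]].
    destruct (P b) eqn:E; cbn; [|ring]. exfalso. apply Hb.
    rewrite (Hun b); try easy. now left.
Qed.

(** If p divides c, only the line of (0, 1) passes through (c, d). Otherwise the line of (1, t) does
    exactly when c t = d modulo p, which has one solution t. *)
Lemma proj_line_unique p c d : prime p -> ~ ((p | c) /\ (p | d))%Z ->
  lsum (proj_line p) (fun m => ind (dvdb p (cross m c d))) = 1.
Proof.
  intros Hp Hcd. pose proof (two_le_prime p Hp). unfold proj_line.
  rewrite lsum_cons, lsum_map. unfold cross at 1; cbn [mI mc md].
  replace (c * 1 - d * 0)%Z with c by ring.
  destruct (dvdb p c) eqn:Hc.
  - apply dvdb_iff in Hc; [|lia].
    rewrite (lsum_ext _ _ (fun _ => 0)); [rewrite lsum_const; cbn; ring|].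
    intros t _. destruct (dvdb p _) eqn:E; [|easy]. exfalso. apply dvdb_iff in E; [|lia].
    apply Hcd. split; [easy|]. unfold cross in E; cbn in E.
    replace d with (c * Z.of_nat t - (c * Z.of_nat t - d * 1))%Z by ring.
    apply Z.divide_sub_r; [now apply Z.divide_mul_l|easy].
  - assert (Hc' : ~ (p | c)%Z) by (intros Hd; apply dvdb_iff in Hd; [congruence|lia]).
    pose proof (prime_rel_prime p Hp c Hc') as Hrel.
    destruct (rel_prime_bezout _ _ Hrel) as [u v Huv].
    (* The Bezout coefficient v inverts c modulo p, so [t0] is d / c. *)
    set (t0 := ((v * d) mod p)%Z).
    assert (Ht0 : (0 <= t0 < p)%Z) by (apply Z.mod_pos_bound; lia).
    rewrite (lsum_ind_single _ _ (Z.to_nat t0)); [cbn; ring|apply seq_NoDup| | |].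
    + apply in_seq. lia.
    + apply dvdb_iff; [lia|]. unfold cross; cbn. rewrite Z2Nat.id by lia.
      unfold t0. rewrite Z.mod_eq by lia.
      exists (- u * d - c * (v * d / p))%Z.
      transitivity (c * (v * d - p * (v * d / p)) - (u * p + v * c) * d)%Z; [rewrite Huv|]; ring.
    + intros t Ht HE. apply in_seq in Ht. apply dvdb_iff in HE; [|lia].
      unfold cross in HE; cbn in HE.
      assert (Hd : (p | Z.of_nat t - t0)%Z).
      { apply Gauss with c; [|easy].
        assert (Ht0' : (p | c * t0 - d)%Z).
        { unfold t0. rewrite Z.mod_eq by lia. exists (- u * d - c * (v * d / p))%Z.
          transitivity (c * (v * d - p * (v * d / p)) - (u * p + v * c) * d)%Z;
            [rewrite Huv|]; ring. }
        replace (c * (Z.of_nat t - t0))%Z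
          with ((c * Z.of_nat t - d * 1) - (c * t0 - d))%Z by ring.
        now apply Z.divide_sub_r. }
      destruct Hd as [k Hk]. assert (k = 0)%Z by nia. subst k. lia.
Qed.

Definition surjective_mod (G : mat -> bool) (Bad : Z) : Prop :=
  forall q : Z, sqfreeb q = true -> Z.gcd q Bad = 1%Z ->
     forall m : mat, (mdet m mod q = 1 mod q)%Z ->
       exists g, G g = true /\ mcong g m q.

Lemma bottom_row_primitive g p : prime p -> mdet g = 1%Z -> ~ ((p | mc g) /\ (p | md g))%Z.
Proof.
  intros Hp Hg [[i Hi] [j Hj]]. unfold mdet in Hg. rewrite Hi, Hj in Hg.
  assert (H : (p | 1)%Z) by (exists (ma g * j - mb g * i)%Z; rewrite <- Hg; ring).
  apply two_le_prime in Hp. apply Z.divide_1_r_nonneg in H; lia.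
Qed.

(** The representatives are lifts to Gamma of the matrices for the lines modulo q. A bottom row of
    determinant-one matrices is primitive at every prime, hence lies on exactly one of these
    lines. *)
Lemma gamma0_index G Bad ps :
  is_subgroup G -> in_SL2Z G -> surjective_mod G Bad ->
  NoDup ps -> (forall p, In p ps -> prime p) -> (forall p, In p ps -> Z.gcd p Bad = 1%Z) ->
  exists n, is_index G (gamma0 G (zprod ps)) n /\ INR n = lprod ps (fun p => IZR p + 1).
Proof.
  intros HG HSL Hsurj Hnd Hpr Hgcd.
  destruct (crt_lines ps proj_line) as [M [Hlen [Hdet Hcount]]]; try easy.
  { intros p m Hp Hm. unfold proj_line in Hm. destruct Hm as [<-|Hm].
    - exists 0%Z. reflexivity.
    - apply in_map_iff in Hm. destruct Hm as [t [<- _]]. exists 0%Z. reflexivity. }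
  set (q := zprod ps) in *.
  assert (Hq : (0 < q)%Z) by now apply zprod_pos.
  destruct (Forall2_choice (fun m g => G g = true /\ mcong g m q) M) as [reps Hreps].
  { intros m Hm. apply Hsurj; [now apply sqfreeb_zprod|now apply gcd_zprod|].
    apply mod_eq_divide; [easy|now apply Hdet]. }
  assert (HrG : forall r, In r reps -> G r = true).
  { clear - Hreps. induction Hreps as [|m r M reps [Hr _] _ IH]; [easy|].
    intros s [<-|Hs]; [easy|now apply IH]. }
  exists (length reps). split.
  - exists reps. split; [easy|]. split; [easy|]. intros g Hg.
    apply INR_eq. change (INR 1) with 1. rewrite <- lsum_ind_length.
    transitivity (lprod ps (fun _ => 1)); [|now rewrite lprod_const, pow1].
    transitivity (lsum M (fun m => ind (dvdb q (cross m (mc g) (md g))))).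
    + clear Hlen Hdet Hcount.
      induction Hreps as [|m r M reps [Hr Hc] _ IH]; [easy|]. rewrite !lsum_cons. f_equal.
      * f_equal. unfold gamma0. rewrite mc_mul_minv.
        destruct HG as [_ [Hmul Hinv]]. rewrite Hmul, andb_true_l by auto.
        apply mcong_bottom in Hc; [|easy]. now apply dvdb_cross_cong.
      * apply IH. intros; apply HrG; now right.
    + rewrite Hcount. apply lprod_ext. intros p Hp. apply proj_line_unique; [now apply Hpr|].
      apply bottom_row_primitive; [now apply Hpr|now apply HSL].
  - rewrite <- (Forall2_length Hreps), Hlen. apply lprod_ext. intros p Hp.
    specialize (Hpr p Hp). apply two_le_prime in Hpr.
    unfold proj_line. cbn [length]. rewrite S_INR, length_map, length_seq, INR_IZR_INZ, Z2Nat.id by lia.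
    ring.
Qed.

(** * Zeros of the forms modulo p *)

(** A matching without fixed points: remove an element together with its partner and induct. A
    relation is used so that no partner function has to be constructed. *)
Lemma even_length_of_pairing {A} (E : A -> A -> Prop) (l : list A) :
  NoDup l -> (forall a b, E a b -> E b a) ->
  (forall a, In a l -> ~ E a a) ->
  (forall a, In a l -> exists b, In b l /\ E a b) ->
  (forall a b c, In a l -> In b l -> In c l -> E a b -> E a c -> b = c) ->
  Nat.Even (length l).
Proof.
  intros Hnd Hsym. remember (length l) as n eqn:Hn. revert l Hn Hnd.
  induction n as [n IH] using lt_wf_ind. intros l Hn Hnd Hirr Hex Hun.
  destruct l as [|a l]; [exists 0%nat; easy|].
  destruct (Hex a) as [b [Hb Hab]]; [now left|].
  destruct Hb as [<-|Hb]; [exfalso; apply (Hirr a); [now left|easy]|].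
  destruct (in_split b l Hb) as [l1 [l2 ->]].
  assert (Hin : forall c, In c (l1 ++ l2) -> In c (a :: l1 ++ b :: l2)).
  { intros c Hc. right. apply in_app_iff in Hc. apply in_app_iff. cbn. tauto. }
  apply NoDup_cons_iff in Hnd. destruct Hnd as [Ha Hnd].
  pose proof (NoDup_remove_1 _ _ _ Hnd) as Hnd'. pose proof (NoDup_remove_2 _ _ _ Hnd) as Hb'.
  assert (Hlen : n = S (S (length (l1 ++ l2)))).
  { rewrite Hn. cbn. rewrite !length_app. cbn. lia. }
  destruct (IH (length (l1 ++ l2))) with (l := l1 ++ l2) as [k Hk]; try easy; try lia.
  - intros c Hc. apply Hirr, Hin, Hc.
  - intros c Hc. destruct (Hex c (Hin c Hc)) as [d [Hd Hcd]]. exists d. split; [|easy].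
    assert (Hcl : In c (l1 ++ b :: l2)) by (destruct (Hin c Hc) as [<-|]; [|easy];
      apply in_app_iff in Hc; exfalso; apply Ha, in_app_iff; cbn; tauto).
    destruct Hd as [<-|Hd].
    + exfalso. apply Hb'. rewrite <- (Hun a c b); try easy; try (now left);
        [now apply Hin|now right|now apply Hsym].
    + apply in_app_iff in Hd. cbn in Hd. destruct Hd as [Hd|[<-|Hd]].
      * apply in_app_iff; now left.
      * exfalso. apply Ha. rewrite (Hun b a c); try easy; try (now right); try (now left); now apply Hsym.
      * apply in_app_iff; now right.
  - intros c d e Hc Hd He. apply Hun; now apply Hin.
  - exists (S k). lia.
Qed.

(* Pair a with the b satisfying ab = 1 or ab = -1 (mod p) among 2, ..., (p-1)/2:
   this is an odd number of integers, so some a is its own partner. *)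
Lemma sqrt_minus_one p : prime p -> (p mod 4 = 1)%Z -> exists i, (p | i * i + 1)%Z.
Proof.
  intros Hp Hp4. pose proof (two_le_prime p Hp).
  set (k := (p / 4)%Z). assert (Hk : p = (4 * k + 1)%Z) by (unfold k; rewrite <- Hp4; apply Z.div_mod; lia).
  set (l := map Z.of_nat (seq 2 (Z.to_nat (2 * k - 1)))).
  assert (Hl : forall a, In a l <-> (2 <= a <= 2 * k)%Z).
  { intros a. unfold l. rewrite in_map_iff. split.
    - intros [t [<- Ht]]. apply in_seq in Ht. lia.
    - intros Ha. exists (Z.to_nat a). rewrite in_seq. lia. }
  destruct (Exists_dec (fun a => (p | a * a + 1)%Z) l) as [HE|HE].
  { intros a. apply Zdivide_dec. }
  { apply Exists_exists in HE. destruct HE as [a [_ Ha]]. now exists a. }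
  exfalso.
  assert (Heven : Nat.Even (length l)).
  { apply (even_length_of_pairing (fun a b => (p | a * b - 1)%Z \/ (p | a * b + 1)%Z)).
    - apply FinFun.Injective_map_NoDup; [intros a b; lia|apply seq_NoDup].
    - intros a b. now rewrite (Z.mul_comm b a).
    - intros a Ha [Hd|Hd].
      + replace (a * a - 1)%Z with ((a - 1) * (a + 1))%Z in Hd by ring.
        apply Hl in Ha. destruct (prime_mult p Hp _ _ Hd) as [H1|H1];
          apply Z.divide_pos_le in H1; lia.
      + apply HE, Exists_exists. now exists a.
    - intros a Ha. apply Hl in Ha.
      assert (Hna : ~ (p | a)%Z) by (intros H1; apply Z.divide_pos_le in H1; lia).
      destruct (rel_prime_bezout _ _ (prime_rel_prime p Hp a Hna)) as [u v Huv].
      set (r := (v mod p)%Z).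
      assert (Hr : (0 <= r < p)%Z) by (apply Z.mod_pos_bound; lia).
      assert (Har : (p | a * r - 1)%Z).
      { unfold r. rewrite Z.mod_eq by lia. exists (- u - a * (v / p))%Z.
        transitivity (a * (v - p * (v / p)) - (u * p + v * a))%Z; [rewrite Huv|]; ring. }
      assert (r <> 0)%Z.
      { intros Hr0. rewrite Hr0 in Har. destruct Har as [t Ht]. nia. }
      assert (r <> 1)%Z.
      { intros Hr0. rewrite Hr0 in Har. apply Z.divide_pos_le in Har; lia. }
      assert (r <> p - 1)%Z.
      { intros Hr0. assert (Hd : (p | a + 1)%Z).
        { replace (a + 1)%Z with (a * p - (a * r - 1))%Z by (rewrite Hr0; ring).
          apply Z.divide_sub_r; [apply Z.divide_factor_r|easy]. }
        apply Z.divide_pos_le in Hd; lia. }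
      (* An inverse beyond (p-1)/2 = 2k is replaced by its negative p - r, for which the product
         with a is -1. *)
      destruct (Z_le_gt_dec r (2 * k)) as [Hr2|Hr2].
      + exists r. split; [apply Hl; lia|now left].
      + exists (p - r)%Z. split; [apply Hl; lia|right].
        replace (a * (p - r) + 1)%Z with (a * p - (a * r - 1))%Z by ring.
        apply Z.divide_sub_r; [apply Z.divide_factor_r|easy].
    - intros a b c Ha Hb Hc Hab Hac. apply Hl in Ha, Hb, Hc.
      assert (Hrel : rel_prime p a).
      { apply prime_rel_prime; [easy|]. intros H1; apply Z.divide_pos_le in H1; lia. }
      (* Equal signs give p | b - c, opposite signs p | b + c; the latter is impossible because 0 <
         b + c < p. *)
      assert (H1 : (p | b - c)%Z \/ (p | b + c)%Z).
      { destruct Hab as [H1|H1], Hac as [H2|H2];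
          [left|right|right|left]; apply Gauss with a; try easy.
        - replace (a * (b - c))%Z with ((a * b - 1) - (a * c - 1))%Z by ring. now apply Z.divide_sub_r.
        - replace (a * (b + c))%Z with ((a * b - 1) + (a * c + 1))%Z by ring. now apply Z.divide_add_r.
        - replace (a * (b + c))%Z with ((a * b + 1) + (a * c - 1))%Z by ring. now apply Z.divide_add_r.
        - replace (a * (b - c))%Z with ((a * b + 1) - (a * c + 1))%Z by ring. now apply Z.divide_sub_r. }
      destruct H1 as [[t Ht]|H1]; [|apply Z.divide_pos_le in H1; lia].
      assert (t = 0)%Z by nia. subst t. lia. }
  destruct Heven as [t Ht]. unfold l in Ht. rewrite length_map, length_seq in Ht. lia.
Qed.

Lemma good_prime_gcd f Bad p : good_prime f Bad p = true -> Z.gcd p Bad = 1%Z.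
Proof. unfold good_prime. rewrite andb_true_iff, Z.eqb_eq. easy. Qed.

(** The vanishing of n is the disjoint union of the vanishing of u and of v. The trailing [+ 0] is
    what [lsum] over a two-element list reduces to. *)
Lemma ind_two_lines p n u v : prime p -> ~ ((p | u) /\ (p | v))%Z ->
  ((p | n) <-> (p | u * v))%Z -> ind (dvdb p u) + (ind (dvdb p v) + 0) = ind (dvdb p n).
Proof.
  intros Hp Huv Hn. pose proof (two_le_prime p Hp).
  destruct (dvdb p u) eqn:Hu; destruct (dvdb p v) eqn:Hv; destruct (dvdb p n) eqn:E; cbn;
    try ring; exfalso;
    rewrite <- ?not_true_iff_false, !dvdb_iff in * by lia.
  1, 2: tauto.
  - apply E, Hn. now apply Z.divide_mul_l.
  - apply E, Hn. now apply Z.divide_mul_r.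
  - apply Hn in E. destruct (prime_mult p Hp _ _ E); tauto.
Qed.

(** Each form splits into two linear factors modulo p: (d - c)(d + c), 2 c d, and (c - i d)(c + i d)
    with i^2 = -1. As 2 divides [Bad], p is odd; this separates the two lines of the first and third
    form and cancels the 2 in the second. *)
Lemma form_lines f Bad p : (2 | Bad)%Z -> prime p -> good_prime f Bad p = true ->
  exists L : list mat, length L = 2%nat /\ (forall m, In m L -> mdet m = 1%Z) /\
    forall c d, ~ ((p | c) /\ (p | d))%Z ->
      lsum L (fun m => ind (dvdb p (cross m c d))) = ind (dvdb p (feval f c d)).
Proof.
  intros HB Hp Hgood. pose proof (two_le_prime p Hp).
  assert (H2 : ~ (p | 2)%Z).
  { intros Hd. apply Z.divide_pos_le in Hd as Hle; [|lia]. assert (p = 2)%Z by lia. subst p.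
    apply good_prime_gcd in Hgood. assert (H1 : (2 | Z.gcd 2 Bad)%Z)
      by (apply Z.gcd_greatest; [apply Z.divide_refl|easy]).
    rewrite Hgood in H1. apply Z.divide_pos_le in H1; lia. }
  assert (Hhalf : forall a, (p | 2 * a)%Z -> (p | a)%Z).
  { intros a Ha. destruct (prime_mult p Hp _ _ Ha); tauto. }
  (* The sum of the two factors is 2 c and their difference 2 i d, so a common zero would make c and
     d both divisible by p. *)
  assert (Hsplit : forall i c d, ~ ((p | c) /\ (p | d))%Z -> ~ (p | i)%Z ->
    ~ ((p | c - i * d) /\ (p | c + i * d))%Z).
  { intros i c d Hcd Hi [H3 H4]. apply Hcd. split; apply Hhalf.
    - replace (2 * c)%Z with ((c - i * d) + (c + i * d))%Z by ring. now apply Z.divide_add_r.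
    - assert (H5 : (p | i * (2 * d))%Z).
      { replace (i * (2 * d))%Z with ((c + i * d) - (c - i * d))%Z by ring. now apply Z.divide_sub_r. }
      destruct (prime_mult p Hp _ _ H5); [now elim Hi|easy]. }
  assert (H1 : ~ (p | 1)%Z) by (intros Hd; apply Z.divide_1_r_nonneg in Hd; lia).
  destruct f.
  - exists (Mat 1 0 1 1 :: Mat (-1) 0 1 (-1) :: nil). split; [easy|]. split.
    { intros m [<-|[<-|[]]]; easy. }
    intros c d Hcd. apply ind_two_lines; [easy| |].
    + intros [H3 H4]. apply (Hsplit 1%Z c d Hcd H1). unfold cross in *; cbn in H3, H4. split.
      * now replace (c - 1 * d)%Z with (c * 1 - d * 1)%Z by ring.
      * replace (c + 1 * d)%Z with (- (c * -1 - d * 1))%Z by ring. now apply Z.divide_opp_r.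
    + unfold cross, feval; cbn [mc md].
      now replace ((c * 1 - d * 1) * (c * -1 - d * 1))%Z with (d ^ 2 - c ^ 2)%Z by ring.
  - exists (mI :: Mat 0 (-1) 1 0 :: nil). split; [easy|]. split.
    { intros m [<-|[<-|[]]]; easy. }
    intros c d Hcd. apply ind_two_lines; [easy| |].
    + intros [H3 H4]. apply Hcd. unfold cross in *; cbn in H3, H4. split.
      * now replace c with (c * 1 - d * 0)%Z by ring.
      * replace d with (- (c * 0 - d * 1))%Z by ring. now apply Z.divide_opp_r.
    + unfold cross, feval; cbn [mc md mI].
      replace ((c * 1 - d * 0) * (c * 0 - d * 1))%Z with (- (c * d))%Z by ring.
      rewrite Z.divide_opp_r, <- Z.mul_assoc. split; [apply Hhalf|apply Z.divide_mul_r].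
  - unfold good_prime in Hgood. apply andb_true_iff in Hgood. destruct Hgood as [_ Hp4].
    apply Z.eqb_eq in Hp4. destruct (sqrt_minus_one p Hp Hp4) as [i Hi].
    assert (Hpi : ~ (p | i)%Z).
    { intros Hd. apply H1. replace 1%Z with ((i * i + 1) - i * i)%Z by ring.
      apply Z.divide_sub_r; [easy|now apply Z.divide_mul_l]. }
    exists (Mat 1 0 i 1 :: Mat 1 0 (- i) 1 :: nil). split; [easy|]. split.
    { intros m [<-|[<-|[]]]; unfold mdet; cbn [ma mb mc md]; ring. }
    intros c d Hcd. apply ind_two_lines; [easy| |].
    + intros [H3 H4]. apply (Hsplit i c d Hcd Hpi). unfold cross in *; cbn in H3, H4. split.
      * now replace (c - i * d)%Z with (c * 1 - d * i)%Z by ring.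
      * now replace (c + i * d)%Z with (c * 1 - d * - i)%Z by ring.
    + unfold cross, feval; cbn [mc md].
      replace ((c * 1 - d * i) * (c * 1 - d * - i))%Z
        with (c ^ 2 + d ^ 2 - (d * d) * (i * i + 1))%Z by ring.
      assert (H3 : (p | (d * d) * (i * i + 1))%Z) by now apply Z.divide_mul_r.
      split; intros H4.
      * now apply Z.divide_sub_r.
      * replace (c ^ 2 + d ^ 2)%Z with (c ^ 2 + d ^ 2 - (d * d) * (i * i + 1)
          + (d * d) * (i * i + 1))%Z by ring.
        now apply Z.divide_add_r.
Qed.

(** * Equidistribution of the values of the form *)

Definition beta_p (p : Z) : R := 2 / (IZR p + 1).

Definition good_primes (f : form) (Bad : Z) (ps : list Z) : Prop :=
  forall p, In p ps -> prime p /\ good_prime f Bad p = true.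

(** The equidistribution hypothesis at a single X, with the error bound abstracted to E, so that
    exponents stay out of the coset arithmetic. *)
Definition equidistributed (G : mat -> bool) (Bad : Z) (Ups : R -> mat -> R) (X E : R) : Prop :=
  forall g0, G g0 = true ->
  forall q : Z, sqfreeb q = true -> Z.gcd q Bad = 1%Z ->
  forall H : mat -> bool, is_subgroup H -> (forall g, H g = true -> G g = true) ->
    (forall g, G g = true -> mcong g mI q -> H g = true) ->
    forall n : nat, is_index G H n ->
      Rabs (ballsum (fun g => H (mmul g (minv g0))) (Ups X) (2 * X)
            - / INR n * UpsSum G Ups X) <= E.

Lemma ballsum_lsum G F B :
  ballsum G F B = lsum (boxlist (up B)) (fun g => if G g then F g else 0).
Proof. reflexivity. Qed.

Lemma ballsum_ext G F F' B :
  (forall g, G g = true -> F g = F' g) -> ballsum G F B = ballsum G F' B.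
Proof.
  intros H. rewrite !ballsum_lsum. apply lsum_ext. intros g _.
  destruct (G g) eqn:E; [now apply H|easy].
Qed.

Lemma ballsum_minus G F F' B :
  ballsum G (fun g => F g - F' g) B = ballsum G F B - ballsum G F' B.
Proof.
  rewrite !ballsum_lsum, <- lsum_minus. apply lsum_ext. intros g _. destruct (G g); ring.
Qed.

Lemma ballsum_scal G c F B : ballsum G (fun g => c * F g) B = c * ballsum G F B.
Proof.
  rewrite !ballsum_lsum, <- lsum_scal. apply lsum_ext. intros g _. destruct (G g); ring.
Qed.

Lemma ballsum_lsum_swap {A} G (l : list A) F B :
  ballsum G (fun g => lsum l (F g)) B = lsum l (fun a => ballsum G (fun g => F g a) B).
Proof.
  rewrite ballsum_lsum.
  transitivity (lsum (boxlist (up B)) (fun g => lsum l (fun a => if G g then F g a else 0))).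
  - apply lsum_ext. intros g _. destruct (G g); [easy|]. rewrite lsum_const; ring.
  - now rewrite lsum_swap.
Qed.

Lemma ballsum_le G F F' B :
  (forall g, G g = true -> F g <= F' g) -> ballsum G F B <= ballsum G F' B.
Proof.
  intros H. rewrite !ballsum_lsum. apply lsum_le. intros g _.
  destruct (G g) eqn:E; [now apply H|lra].
Qed.

Lemma ballsum_nonneg G F B : (forall g, G g = true -> 0 <= F g) -> 0 <= ballsum G F B.
Proof.
  intros H. rewrite ballsum_lsum. apply lsum_nonneg. intros g _.
  destruct (G g) eqn:E; [now apply H|lra].
Qed.

Lemma ballsum_abs G F B : Rabs (ballsum G F B) <= ballsum G (fun g => Rabs (F g)) B.
Proof.
  rewrite !ballsum_lsum. eapply Rle_trans; [apply lsum_abs|]. apply lsum_le. intros g _.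
  destruct (G g); [lra|rewrite Rabs_R0; lra].
Qed.

(** Makes a function of the prime out of the two lines known to exist at each prime; [b0] is only
    the value off the list. *)
Lemma finite_choice {A B} (dec : forall a a' : A, {a = a'} + {a <> a'}) (b0 : B)
  (P : A -> B -> Prop) l :
  (forall a, In a l -> exists b, P a b) -> exists h, forall a, In a l -> P a (h a).
Proof.
  induction l as [|a l IH]; intros H; [now exists (fun _ => b0)|].
  destruct (H a) as [b Hb]; [now left|].
  destruct IH as [h Hh]; [intros; apply H; now right|].
  exists (fun c => if dec a c then b else h c). intros c Hc.
  destruct (dec a c) as [<-|Hne]; [easy|]. destruct Hc as [Hc|Hc]; [easy|now apply Hh].
Qed.

Lemma mdet_mmul g h : mdet (mmul g h) = (mdet g * mdet h)%Z.
Proof. unfold mdet; cbn [mmul ma mb mc md]; ring. Qed.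

Lemma mmul_minvK g h : mdet h = 1%Z -> mmul (mmul g (minv h)) h = g.
Proof.
  intros Hh. destruct g as [a b c d]; unfold mdet in Hh; unfold mmul, minv; cbn [ma mb mc md].
  f_equal; match goal with |- _ = ?x => rewrite <- (Z.mul_1_r x) at 3; rewrite <- Hh; ring end.
Qed.

(** The bottom row of g w lies on the line of m exactly when that of g lies on the line of m w^-1.
    Lifting m w^-1 to some g0 in Gamma, such g form the coset of [gamma0] through g0. *)
Lemma line_class_sum G Bad Ups X E ps m w :
  is_subgroup G -> in_SL2Z G -> surjective_mod G Bad -> equidistributed G Bad Ups X E ->
  NoDup ps -> (forall p, In p ps -> prime p) -> (forall p, In p ps -> Z.gcd p Bad = 1%Z) ->
  (zprod ps | mdet m - 1)%Z -> G w = true ->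
  Rabs (ballsum G (fun g => Ups X g *
          ind (dvdb (zprod ps) (cross m (mc (mmul g w)) (md (mmul g w))))) (2 * X)
        - lprod ps (fun p => / (IZR p + 1)) * UpsSum G Ups X) <= E.
Proof.
  intros HG HSL Hsurj Hequi Hnd Hpr Hgcd Hm Hw.
  destruct (gamma0_index G Bad ps) as [n [Hn Hval]]; try easy.
  set (q := zprod ps) in *. assert (Hq : (0 < q)%Z) by now apply zprod_pos.
  assert (Hsq : sqfreeb q = true) by now apply sqfreeb_zprod.
  assert (Hqg : Z.gcd q Bad = 1%Z) by now apply gcd_zprod.
  destruct (Hsurj q Hsq Hqg (mmul m (minv w))) as [g0 [Hg0 Hc]].
  { apply mod_eq_divide; [easy|]. rewrite mdet_mmul.
    replace (mdet (minv w)) with (mdet w) by (unfold mdet; cbn; ring).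
    now rewrite (HSL w Hw), Z.mul_1_r. }
  pose proof (mcong_bottom _ _ _ Hq Hc) as [Hc1 Hc2].
  assert (HGmul := proj1 (proj2 HG)). assert (HGinv := proj2 (proj2 HG)).
  specialize (Hequi g0 Hg0 q Hsq Hqg (gamma0 G q) (gamma0_subgroup G q Hq HG)).
  rewrite lprod_inv, <- Hval.
  replace (ballsum G _ (2 * X))
    with (ballsum (fun g => gamma0 G q (mmul g (minv g0))) (Ups X) (2 * X)).
  - apply Hequi; [| |easy].
    + intros g Hg. now apply andb_true_iff in Hg.
    + intros g Hg Hcg. unfold gamma0. rewrite Hg, andb_true_l. apply dvdb_iff; [easy|].
      apply mcong_bottom in Hcg; [|easy]. destruct Hcg as [Hcg _]. cbn in Hcg.
      now rewrite Z.sub_0_r in Hcg.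
  - rewrite !ballsum_lsum. apply lsum_ext. intros g _. unfold gamma0.
    rewrite mc_mul_minv, (dvdb_cross_cong _ _ _ _ _ Hq Hc1 Hc2).
    replace (cross m _ _) with (cross (mmul m (minv w)) (mc g) (md g))
      by (unfold cross; cbn [mmul minv ma mb mc md]; ring).
    destruct (G g) eqn:EG.
    + rewrite HGmul, andb_true_l by auto. destruct (dvdb _ _); cbn; ring.
    (* The coset sum does not ask for g in G, but g = (g g0^-1) g0 forces it. *)
    + destruct (G (mmul g (minv g0))) eqn:EG'; [|easy].
      rewrite <- (mmul_minvK g g0), HGmul in EG; try easy. now apply HSL.
Qed.

(** Two lines at each prime make 2^k line classes for k primes, each of density prod 1/(p+1) and
    error at most E. *)
Lemma divisibility_sum G Bad Ups f X E ps w :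
  is_subgroup G -> in_SL2Z G -> surjective_mod G Bad -> equidistributed G Bad Ups X E ->
  (2 | Bad)%Z -> NoDup ps -> good_primes f Bad ps -> G w = true ->
  Rabs (ballsum G (fun g => Ups X g *
          lprod ps (fun p => ind (dvdb p (f_x0 f (mmul g w))))) (2 * X)
        - lprod ps beta_p * UpsSum G Ups X) <= 2 ^ length ps * E.
Proof.
  intros HG HSL Hsurj Hequi HB2 Hnd Hgood Hw.
  assert (Hpr : forall p, In p ps -> prime p) by (intros; now apply Hgood).
  assert (Hgcd : forall p, In p ps -> Z.gcd p Bad = 1%Z)
    by (intros p Hp; apply (good_prime_gcd f); now apply Hgood).
  destruct (finite_choice Z.eq_dec nil (fun p L => length L = 2%nat /\
     (forall m, In m L -> mdet m = 1%Z) /\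
     forall c d, ~ ((p | c) /\ (p | d))%Z ->
      lsum L (fun m => ind (dvdb p (cross m c d))) = ind (dvdb p (feval f c d))) ps)
    as [L HL].
  { intros p Hp. destruct (Hgood p Hp). now apply (form_lines f Bad). }
  destruct (crt_lines ps L) as [M [Hlen [Hdet Hcount]]]; try easy.
  { intros p m Hp Hm. destruct (HL p Hp) as [_ [Hd _]]. rewrite Hd by easy. apply Z.divide_0_r. }
  assert (HlenM : INR (length M) = 2 ^ length ps).
  { rewrite Hlen, <- lprod_const. apply lprod_ext. intros p Hp.
    destruct (HL p Hp) as [-> _]. reflexivity. }
  rewrite <- HlenM, <- lsum_const.
  replace (lprod ps beta_p * UpsSum G Ups X)
    with (lsum M (fun _ => lprod ps (fun p => / (IZR p + 1)) * UpsSum G Ups X)).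
  (* The 2^k equal main terms are absorbed prime by prime: 2 / (p+1) is [beta_p]. *)
  2:{ rewrite lsum_const, HlenM, <- lprod_const, <- Rmult_assoc, <- lprod_mult. f_equal. }
  rewrite (ballsum_ext _ _ (fun g => lsum M (fun m => Ups X g *
          ind (dvdb (zprod ps) (cross m (mc (mmul g w)) (md (mmul g w))))))).
  2:{ intros g Hg. rewrite lsum_scal, Hcount. f_equal. apply lprod_ext. intros p Hp.
      destruct (HL p Hp) as [_ [_ ->]]; [easy|]. apply bottom_row_primitive; [now apply Hpr|].
      apply HSL. destruct HG as [_ [HG _]]. now apply HG. }
  rewrite ballsum_lsum_swap, <- lsum_minus.
  eapply Rle_trans; [apply lsum_abs|]. apply lsum_le. intros m Hm.
  apply (line_class_sum G Bad); try easy. now apply Hdet.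
Qed.

Lemma rho_p_bounds p : prime p -> 0 <= rho_p p <= 1.
Proof.
  intros Hp. apply two_le_prime, IZR_le in Hp. unfold rho_p. split.
  - apply Rle_mult_inv_pos; [lra|nra].
  - apply Rmult_le_reg_r with (IZR p ^ 2); [nra|].
    unfold Rdiv. rewrite Rmult_assoc, Rinv_l by nra. nra.
Qed.

(** Generalised for induction: the primes in [ds] already carry a bare indicator, those in [ps]
    still carry indicator minus rho. Opening the factor at p either moves p to [ds] or drops it with
    weight rho(p). *)
Lemma sifted_sum G Bad Ups f X E ps ds w :
  is_subgroup G -> in_SL2Z G -> surjective_mod G Bad -> equidistributed G Bad Ups X E ->
  (2 | Bad)%Z -> NoDup (ds ++ ps) -> good_primes f Bad (ds ++ ps) -> G w = true ->
  Rabs (ballsum G (fun g => Ups X g *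
          (lprod ds (fun p => ind (dvdb p (f_x0 f (mmul g w)))) *
           lprod ps (fun p => ind (dvdb p (f_x0 f (mmul g w))) - rho_p p))) (2 * X)
        - lprod ds beta_p * lprod ps (fun p => beta_p p - rho_p p) * UpsSum G Ups X)
    <= 2 ^ length ds * 3 ^ length ps * E.
Proof.
  intros HG HSL Hsurj Hequi HB2. revert ds.
  induction ps as [|p ps IH]; intros ds Hnd Hgood Hw.
  - rewrite app_nil_r in *. unfold lprod at 2 4; cbn [map fold_right length pow].
    rewrite !Rmult_1_r.
    rewrite (ballsum_ext _ _ (fun g => Ups X g *
          lprod ds (fun p => ind (dvdb p (f_x0 f (mmul g w)))))) by (intros; ring).
    now apply (divisibility_sum G Bad).
  - assert (HP : Permutation (ds ++ p :: ps) ((p :: ds) ++ ps))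
      by (symmetry; apply Permutation_middle).
    assert (Hnd1 : NoDup ((p :: ds) ++ ps)) by now apply (Permutation_NoDup HP).
    assert (Hgood1 : good_primes f Bad ((p :: ds) ++ ps))
      by (intros r Hr; apply Hgood, (Permutation_in r (Permutation_sym HP)), Hr).
    pose proof (IH (p :: ds) Hnd1 Hgood1 Hw) as H1.
    assert (H2 := IH ds). cbn [app] in Hnd1. apply NoDup_cons_iff in Hnd1.
    destruct Hnd1 as [_ Hnd2]. specialize (H2 Hnd2).
    assert (Hgood2 : good_primes f Bad (ds ++ ps)) by (intros r Hr; apply Hgood1; now right).
    specialize (H2 Hgood2 Hw).
    assert (Hrho : 0 <= rho_p p <= 1) by (apply rho_p_bounds, Hgood1; now left).
    rewrite (ballsum_ext _ _ (fun g =>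
       Ups X g * (lprod (p :: ds) (fun p => ind (dvdb p (f_x0 f (mmul g w)))) *
           lprod ps (fun p => ind (dvdb p (f_x0 f (mmul g w))) - rho_p p))
       - rho_p p * (Ups X g * (lprod ds (fun p => ind (dvdb p (f_x0 f (mmul g w)))) *
           lprod ps (fun p => ind (dvdb p (f_x0 f (mmul g w))) - rho_p p)))))
      by (intros g _; rewrite !lprod_cons; ring).
    rewrite ballsum_minus, ballsum_scal.
    rewrite !lprod_cons in *. cbn [length pow] in *.
    (* A and B are the two resulting sums, A' and B' their main terms. The errors add up by 2 * 2^a
       3^b + rho(p) 2^a 3^b <= 2^a 3^(b+1), with a and b the lengths of [ds] and [ps]. *)
    match type of H1 with Rabs (?a - ?b) <= _ => set (A := a) in *; set (A' := b) in * end.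
    match type of H2 with Rabs (?a - ?b) <= _ => set (B := a) in *; set (B' := b) in * end.
    replace (A - rho_p p * B - _) with ((A - A') - rho_p p * (B - B')) by (unfold A', B'; ring).
    eapply Rle_trans; [apply Rabs_triang|]. rewrite Rabs_Ropp, Rabs_mult.
    rewrite (Rabs_right (rho_p p)) by lra. pose proof (Rabs_pos (B - B')). nra.
Qed.

(** Equidistribution concerns the sum over gamma for a fixed omega, so the sum over omega has to be
    the outer one. *)
Lemma innerS_swap G Ups f q X Y :
  innerS G Ups f q X Y =
  ballsum (Omega G Y) (fun w =>
    ballsum G (fun g => Ups X g * Xi q (f_x0 f (mmul g w))) (2 * X)) Y.
Proof.
  unfold innerS.
  rewrite (ballsum_ext G _ (fun g => lsum (boxlist (up Y)) (fun w =>
     if Omega G Y w then Ups X g * Xi q (f_x0 f (mmul g w)) else 0))).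
  - rewrite ballsum_lsum_swap. rewrite (ballsum_lsum (Omega G Y)). apply lsum_ext. intros w _.
    destruct (Omega G Y w); [easy|].
    rewrite (ballsum_ext _ _ (fun _ => 0 * 0)) by (intros; ring). rewrite ballsum_scal; ring.
  - intros g _. rewrite ballsum_lsum, <- lsum_scal. apply lsum_ext. intros w _.
    destruct (Omega G Y w); ring.
Qed.

Lemma Omega_in G Y w : Omega G Y w = true -> G w = true.
Proof. unfold Omega. rewrite andb_true_iff. easy. Qed.

Lemma OmegaCard_nonneg G Y : 0 <= OmegaCard G Y.
Proof. apply ballsum_nonneg; intros; lra. Qed.

Lemma OmegaCard_scal G Y c : ballsum (Omega G Y) (fun _ => c) Y = OmegaCard G Y * c.
Proof.
  rewrite (ballsum_ext _ _ (fun _ => c * 1)) by (intros; ring). rewrite ballsum_scal.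
  unfold OmegaCard; ring.
Qed.

Lemma innerS_equidistributed G Bad Ups f X Y E q :
  is_subgroup G -> in_SL2Z G -> surjective_mod G Bad -> equidistributed G Bad Ups X E ->
  (2 | Bad)%Z -> good_primes f Bad (pfactors q) ->
  Rabs (innerS G Ups f q X Y - prodp q (fun p => beta_p p - rho_p p) * chi G Ups X Y)
    <= OmegaCard G Y * (3 ^ length (pfactors q) * E).
Proof.
  intros HG HSL Hsurj Hequi HB2 Hgood.
  rewrite innerS_swap, <- OmegaCard_scal. unfold chi.
  replace (prodp q _ * (OmegaCard G Y * UpsSum G Ups X))
    with (OmegaCard G Y * (prodp q (fun p => beta_p p - rho_p p) * UpsSum G Ups X)) by ring.
  rewrite <- OmegaCard_scal, <- ballsum_minus.
  eapply Rle_trans; [apply ballsum_abs|]. apply ballsum_le. intros w Hw.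
  pose proof (sifted_sum G Bad Ups f X E (pfactors q) nil w HG HSL Hsurj Hequi HB2
    (NoDup_pfactors q) Hgood (Omega_in _ _ _ Hw)) as H.
  unfold lprod at 1 3 in H; cbn [map fold_right length pow] in H. rewrite !Rmult_1_l in H.
  rewrite (ballsum_ext G _ (fun g => Ups X g *
    (1 * lprod (pfactors q) (fun p => ind (dvdb p (f_x0 f (mmul g w))) - rho_p p)))).
  - exact H.
  - intros g _. rewrite Rmult_1_l. reflexivity.
Qed.

Lemma Rabs_Xi_le q n : (0 < q)%Z -> Rabs (Xi q n) <= 1.
Proof.
  intros Hq. unfold Xi. rewrite prodp_lprod. apply lprod_abs_le1. intros p Hp.
  apply in_pfactors in Hp; [|easy]. pose proof (rho_p_bounds p (proj1 Hp)).
  destruct (Z.eqb _ _); unfold Rabs; destruct Rcase_abs; lra.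
Qed.

(** The trivial bound, for the bounded range of X in which the asymptotics of the sum of Ups say
    nothing. *)
Lemma Rabs_innerS_le G Ups f q X Y :
  (forall X g, 0 <= Ups X g <= 1) -> (0 < q)%Z ->
  Rabs (innerS G Ups f q X Y) <= chi G Ups X Y.
Proof.
  intros HU Hq. rewrite innerS_swap. unfold chi. rewrite <- OmegaCard_scal.
  eapply Rle_trans; [apply ballsum_abs|]. apply ballsum_le. intros w _.
  eapply Rle_trans; [apply ballsum_abs|]. apply ballsum_le. intros g _.
  rewrite Rabs_mult, (Rabs_right (Ups X g)) by (apply Rle_ge, HU).
  pose proof (Rabs_Xi_le q (f_x0 f (mmul g w)) Hq). pose proof (HU X g).
  pose proof (Rabs_pos (Xi q (f_x0 f (mmul g w)))). nra.
Qed.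

Lemma UpsSum_nonneg G Ups X : (forall X g, 0 <= Ups X g <= 1) -> 0 <= UpsSum G Ups X.
Proof. intros HU. apply ballsum_nonneg. intros g _. apply HU. Qed.

Lemma chi_nonneg G Ups X Y : (forall X g, 0 <= Ups X g <= 1) -> 0 <= chi G Ups X Y.
Proof. intros HU. apply Rmult_le_pos; [apply OmegaCard_nonneg|now apply UpsSum_nonneg]. Qed.

(** The leading terms 2/p cancel: the difference equals -(p-1) / ((p+1) p^2). *)
Lemma beta_p_sub_rho_p p : prime p -> Rabs (beta_p p - rho_p p) <= / IZR p ^ 2.
Proof.
  intros Hp. apply two_le_prime, IZR_le in Hp. unfold beta_p, rho_p.
  replace (2 / (IZR p + 1) - (2 * IZR p - 1) / IZR p ^ 2)
    with (- ((IZR p - 1) / (IZR p + 1) * / IZR p ^ 2)) by (field; lra).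
  assert (H0 : 0 < / IZR p ^ 2) by (apply Rinv_0_lt_compat; nra).
  assert (H1 : 0 <= (IZR p - 1) / (IZR p + 1) <= 1).
  { split; [apply Rle_mult_inv_pos; lra|]. apply Rmult_le_reg_r with (IZR p + 1); [lra|].
    unfold Rdiv. rewrite Rmult_assoc, Rinv_l by lra. lra. }
  rewrite Rabs_Ropp, Rabs_right by nra. nra.
Qed.

Lemma Rabs_prodp_beta_rho_le q :
  sqfreeb q = true -> Rabs (prodp q (fun p => beta_p p - rho_p p)) <= / IZR q ^ 2.
Proof.
  intros Hq. rewrite prodp_lprod, lprod_abs.
  replace (/ IZR q ^ 2) with (lprod (pfactors q) (fun p => / IZR p ^ 2)).
  - apply lprod_le. intros p Hp. apply in_pfactors in Hp; [|now apply sqfreeb_pos].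
    split; [apply Rabs_pos|now apply beta_p_sub_rho_p].
  - rewrite lprod_inv. f_equal. rewrite <- (prodp_IZR q Hq), prodp_lprod. cbn [pow].
    rewrite lprod_mult. f_equal. rewrite lprod_mult. f_equal.
    rewrite lprod_const. apply pow1.
Qed.

(** * Divisor sums *)

Lemma Rltb_true a b : Rltb a b = true <-> a < b.
Proof. unfold Rltb. destruct (Rlt_dec a b); split; easy. Qed.

Lemma Rltb_false a b : Rltb a b = false <-> b <= a.
Proof. unfold Rltb. destruct (Rlt_dec a b); split; intros; try easy; lra. Qed.

Lemma lprod_Rpower (l : list Z) e :
  (forall a, In a l -> 0 < IZR a) ->
  0 < lprod l IZR /\ lprod l (fun a => Rpower (IZR a) e) = Rpower (lprod l IZR) e.
Proof.
  induction l as [|a l IH]; intros H.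
  - unfold lprod; cbn. split; [lra|]. unfold Rpower. rewrite ln_1, Rmult_0_r, exp_0. easy.
  - rewrite !lprod_cons. destruct IH as [H0 ->]; [intros; apply H; now right|].
    assert (0 < IZR a) by (apply H; now left). split; [now apply Rmult_lt_0_compat|].
    now apply Rpower_mult_distr.
Qed.

Lemma Rpower_ge_1 a e : 1 <= a -> 0 <= e -> 1 <= Rpower a e.
Proof.
  intros Ha He. rewrite <- (Rpower_O a) by lra. now apply Rle_Rpower.
Qed.

(* Only the boundedly many primes p with p^eps < C contribute a factor C exceeding p^eps. *)
Lemma omega_power_bound C eps : 1 <= C -> 0 < eps ->
  exists K, 0 < K /\ forall q, sqfreeb q = true ->
    C ^ length (pfactors q) <= K * Rpower (IZR q) eps.
Proof.
  (* [P0] is the point from which on p^eps >= C. *)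
  intros HC He. set (P0 := Rpower C (/ eps)).
  assert (HP0 : 0 < P0) by apply exp_pos.
  set (N0 := up P0). destruct (archimed P0) as [HN _]. fold N0 in HN.
  exists (C ^ Z.to_nat N0). split; [apply pow_lt; lra|]. intros q Hq.
  pose proof (sqfreeb_pos q Hq) as Hpos.
  rewrite <- (prodp_IZR q Hq), prodp_lprod.
  destruct (lprod_Rpower (pfactors q) eps) as [_ <-].
  { intros p Hp. apply in_pfactors in Hp; [|easy]. apply IZR_lt.
    pose proof (two_le_prime p (proj1 Hp)). lia. }
  rewrite <- lprod_const.
  apply Rle_trans with (lprod (pfactors q) (fun p => (if Z.ltb p N0 then C else 1)
    * Rpower (IZR p) eps)).
  - apply lprod_le. intros p Hp. split; [lra|]. apply in_pfactors in Hp; [|easy].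
    destruct Hp as [Hp _]. apply two_le_prime, IZR_le in Hp.
    pose proof (Rpower_ge_1 (IZR p) eps ltac:(lra) ltac:(lra)).
    destruct (Z.ltb_spec p N0) as [Hlt|Hge]; [nra|]. rewrite Rmult_1_l.
    apply IZR_le in Hge.
    replace C with (Rpower P0 eps).
    + apply Rle_Rpower_l; lra.
    + unfold P0. rewrite Rpower_mult, Rinv_l, Rpower_1; lra.
  - rewrite lprod_mult. apply Rmult_le_compat_r.
    { apply lprod_nonneg. intros; apply Rlt_le, exp_pos. }
    replace (lprod _ _) with (C ^ length (filter (fun p => Z.ltb p N0) (pfactors q))).
    + apply Rle_pow; [easy|].
      rewrite <- (length_seq (Z.to_nat N0) 1), <- (length_map Z.of_nat).
      apply NoDup_incl_length; [apply NoDup_filter, NoDup_pfactors|].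
      intros p Hp. apply filter_In in Hp. destruct Hp as [Hp Hlt].
      apply in_pfactors in Hp; [|easy]. destruct Hp as [Hp _]. apply two_le_prime in Hp.
      apply Z.ltb_lt in Hlt. apply in_rng. lia.
    + induction (pfactors q) as [|p l IH]; [reflexivity|]. cbn [filter].
      rewrite lprod_cons, <- IH. destruct (Z.ltb p N0); cbn [length pow]; ring.
Qed.

Lemma rho_nonneg m : 0 <= rho m.
Proof.
  unfold rho. destruct (sqfreeb m) eqn:E; [|lra]. rewrite prodp_lprod.
  apply lprod_nonneg. intros p Hp. apply in_pfactors in Hp; [|now apply sqfreeb_pos].
  apply rho_p_bounds, Hp.
Qed.

Lemma rho_le m : sqfreeb m = true -> rho m <= 2 ^ length (pfactors m) * / IZR m.
Proof.
  intros Hm. rewrite rho_prodp by easy. rewrite <- (prodp_IZR m Hm), !prodp_lprod.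
  rewrite <- lprod_inv, <- lprod_const, <- lprod_mult. apply lprod_le. intros p Hp.
  apply in_pfactors in Hp; [|now apply sqfreeb_pos]. destruct Hp as [Hp _].
  split; [now apply rho_p_bounds|]. apply two_le_prime, IZR_le in Hp. unfold rho_p.
  apply Rmult_le_reg_r with (IZR p ^ 2); [nra|].
  replace ((2 * IZR p - 1) / IZR p ^ 2 * IZR p ^ 2) with (2 * IZR p - 1) by (field; lra).
  replace (2 * / IZR p * IZR p ^ 2) with (2 * IZR p) by (field; lra). lra.
Qed.

Lemma lsum_rng_S n F : lsum (rng (S n)) F = lsum (rng n) F + F (Z.of_nat (S n)).
Proof. rewrite rng_S, lsum_app, lsum_cons. unfold lsum at 2; cbn [map fold_right]. ring. Qed.

Lemma ln_le_sub_1 t : 0 < t -> ln t <= t - 1.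
Proof.
  intros Ht. destruct (Rle_lt_dec (ln t) (t - 1)) as [H|H]; [easy|].
  apply exp_increasing in H. rewrite exp_ln in H by easy.
  pose proof (exp_ineq1_le (t - 1)). lra.
Qed.

Lemma harmonic_le n : (1 <= n)%nat -> lsum (rng n) (fun m => / IZR m) <= 1 + ln (INR n).
Proof.
  induction 1 as [|n Hn IH].
  - change (rng 1) with (1%Z :: nil). rewrite lsum_cons. unfold lsum; cbn. rewrite ln_1. lra.
  - rewrite lsum_rng_S, <- INR_IZR_INZ.
    assert (Hn0 : 1 <= INR n) by (apply (le_INR 1); easy).
    rewrite S_INR.
    (* At t = n/(n+1) this reads 1/(n+1) <= ln(n+1) - ln n. *)
    pose proof (ln_le_sub_1 (INR n * / (INR n + 1))) as H.
    assert (Hp : 0 < / (INR n + 1)) by (apply Rinv_0_lt_compat; lra).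
    rewrite ln_mult, ln_Rinv in H by lra.
    replace (INR n * / (INR n + 1) - 1) with (- / (INR n + 1)) in H by (field; lra).
    assert (0 < INR n * / (INR n + 1)) by (apply Rmult_lt_0_compat; lra).
    specialize (H H0). lra.
Qed.

(** The inequality 1 + s <= exp s at s = e ln t. *)
Lemma ln_le_Rpower t e : 1 <= t -> 0 < e -> ln t <= / e * Rpower t e.
Proof.
  intros Ht He. unfold Rpower. pose proof (exp_ineq1_le (e * ln t)).
  apply Rmult_le_reg_l with e; [easy|]. rewrite <- Rmult_assoc, Rinv_r by lra. lra.
Qed.

(** By [rho_le] the summand is at most 2^omega(m) / m. Half of eps pays for 2^omega(m), the other
    half for the logarithm of the harmonic sum. *)
Lemma sum_rho_bound eps : 0 < eps ->
  exists K, 0 < K /\ forall n, (1 <= n)%nat -> lsum (rng n) rho <= K * Rpower (INR n) eps.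
Proof.
  intros He. set (e := eps / 2). assert (He' : 0 < e) by (unfold e; lra).
  destruct (omega_power_bound 2 e) as [K [HK HB]]; [lra|easy|].
  assert (Hie : 0 < / e) by now apply Rinv_0_lt_compat.
  exists (K * (1 + / e)). split; [nra|]. intros n Hn.
  assert (Hn0 : 1 <= INR n) by (apply (le_INR 1); easy).
  set (R := Rpower (INR n) e).
  assert (HR : 1 <= R) by (apply Rpower_ge_1; lra).
  apply Rle_trans with (K * R * lsum (rng n) (fun m => / IZR m)).
  - rewrite <- lsum_scal. apply lsum_le. intros m Hm. apply in_rng in Hm.
    assert (Hm1 : 1 <= IZR m) by (apply IZR_le; lia).
    assert (Hmn : IZR m <= INR n) by (rewrite INR_IZR_INZ; apply IZR_le; lia).
    assert (Hi : 0 < / IZR m) by (apply Rinv_0_lt_compat; lra).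
    destruct (sqfreeb m) eqn:E.
    + eapply Rle_trans; [now apply rho_le|]. apply Rmult_le_compat_r; [lra|].
      eapply Rle_trans; [now apply HB|]. apply Rmult_le_compat_l; [lra|].
      apply Rle_Rpower_l; lra.
    + unfold rho. rewrite E. apply Rmult_le_pos; nra.
  - replace (Rpower (INR n) eps) with (R * R)
      by (unfold R; rewrite <- Rpower_plus; f_equal; unfold e; lra).
    pose proof (harmonic_le n Hn). pose proof (ln_le_Rpower (INR n) e Hn0 He').
    fold R in H0. assert (H1 : lsum (rng n) (fun m => / IZR m) <= (1 + / e) * R) by nra.
    replace (K * (1 + / e) * (R * R)) with (K * R * ((1 + / e) * R)) by ring.
    apply Rmult_le_compat_l; nra.
Qed.

(** If the last index n is counted, then n < B and the trivial count n suffices; otherwise the count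
    has not changed. *)
Lemma count_lt_bound n B : 0 <= B -> lsum (rng n) (fun q => ind (Rltb (IZR q) B)) <= B.
Proof.
  intros HB.
  assert (Hle : forall n, lsum (rng n) (fun q => ind (Rltb (IZR q) B)) <= INR n).
  { clear n. intros n. apply Rle_trans with (lsum (rng n) (fun _ => 1)).
    - apply lsum_le. intros q _. destruct (Rltb _ _); cbn; lra.
    - rewrite lsum_const. unfold rng. rewrite length_map, length_seq. lra. }
  induction n as [|n IH]; [unfold lsum; cbn; lra|].
  pose proof (Hle (S n)) as H. rewrite lsum_rng_S in *.
  destruct (Rltb (IZR (Z.of_nat (S n))) B) eqn:E; cbn [ind] in *.
  - apply Rltb_true in E. rewrite <- INR_IZR_INZ in E. lra.
  - lra.
Qed.

Lemma inverse_squares_tail n B : 1 <= B ->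
  lsum (rng n) (fun q => if Rltb (IZR q) B then 0 else / IZR q ^ 2) <= 2 / B.
Proof.
  intros HB.
  set (S_ n := lsum (rng n) (fun q => if Rltb (IZR q) B then 0 else / IZR q ^ 2)).
  assert (HB0 : 0 < / B) by (apply Rinv_0_lt_compat; lra).
  (* Strengthened by - 1/n so that the induction telescopes through 1/(n+1)^2 <= 1/n - 1/(n+1). *)
  assert (H : (INR n < B -> S_ n <= 0) /\ (B <= INR n -> S_ n <= 2 / B - / INR n)).
  { induction n as [|n [IH1 IH2]].
    - unfold S_, lsum; cbn. split; intros; lra.
    - unfold S_ in *. rewrite lsum_rng_S, <- INR_IZR_INZ.
      assert (Hn : INR n < INR (S n)) by (rewrite S_INR; lra).
      pose proof (pos_INR n) as Hpos.
      split; intros H.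
      + replace (Rltb (INR (S n)) B) with true by (symmetry; now apply Rltb_true).
        specialize (IH1 ltac:(lra)). lra.
      + replace (Rltb (INR (S n)) B) with false by (symmetry; now apply Rltb_false).
        destruct (Rlt_le_dec (INR n) B) as [H1|H1].
        (* The first index q >= B: 1/q^2 + 1/q <= 2/q <= 2/B, the origin of the constant 2. *)
        * specialize (IH1 H1).
          assert (Hi : / INR (S n) <= / B) by (apply Rinv_le_contravar; lra).
          assert (Hi0 : 0 < / INR (S n)) by (apply Rinv_0_lt_compat; lra).
          assert (Hi1 : / INR (S n) <= 1) by (rewrite <- Rinv_1; apply Rinv_le_contravar; lra).
          rewrite <- pow_inv. nra.
        * specialize (IH2 H1).
          assert (Hd : / INR (S n) ^ 2 <= / INR n - / INR (S n)); [|lra].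
          rewrite S_INR.
          replace (/ INR n - / (INR n + 1)) with (/ (INR n * (INR n + 1))) by (field; lra).
          apply Rinv_le_contravar; nra. }
  destruct H as [H1 H2]. fold (S_ n). destruct (Rlt_le_dec (INR n) B) as [H|H].
  - specialize (H1 H). lra.
  - specialize (H2 H). assert (0 < / INR n) by (apply Rinv_0_lt_compat; lra). lra.
Qed.

Lemma lsum_single {A} (l : list A) a F :
  NoDup l -> In a l -> (forall b, In b l -> b <> a -> F b = 0) -> lsum l F = F a.
Proof.
  intros Hnd Ha H. destruct (in_split a l Ha) as [l1 [l2 ->]].
  rewrite lsum_app, lsum_cons.
  assert (Hn := NoDup_remove_2 _ _ _ Hnd). rewrite in_app_iff in Hn.
  rewrite (lsum_ext l1 F (fun _ => 0)), (lsum_ext l2 F (fun _ => 0)); rewrite ?lsum_const;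
    try ring; intros b Hb; apply H; rewrite ?in_app_iff; cbn; try tauto; intros ->; tauto.
Qed.

Lemma divs_perm q n : In q (rng n) -> Permutation (divs q) (filter (fun d => dvdb d q) (rng n)).
Proof.
  intros Hq. apply in_rng in Hq. apply NoDup_Permutation.
  - apply NoDup_divs.
  - apply NoDup_filter, NoDup_rng.
  - intros d. rewrite in_divs, filter_In, in_rng by lia. split.
    + intros [Hd Hdq]. rewrite dvdb_iff by easy.
      pose proof (Z.divide_pos_le d q ltac:(lia) Hdq). split; [lia|easy].
    + intros [Hd Hdq]. apply dvdb_iff in Hdq; [split; [lia|easy]|lia].
Qed.

(** A pair (d, m) contributes to the single q = d m. By nonnegativity the pairs may be extended to
    the whole square, where the sum factors. *)
Lemma sum_convolution_le n a b : (forall d, 0 <= a d) -> (forall m, 0 <= b m) ->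
  lsum (rng n) (fun q => lsum (divs q) (fun d => a d * b (q / d)%Z))
    <= lsum (rng n) a * lsum (rng n) b.
Proof.
  intros Ha Hb.
  apply Rle_trans with (lsum (rng n) (fun q => lsum (rng n) (fun d => lsum (rng n) (fun m =>
    a d * b m * ind (Z.eqb q (d * m)))))).
  - apply lsum_le. intros q Hq.
    rewrite (lsum_perm _ _ _ (divs_perm q n Hq)), lsum_filter. apply lsum_le. intros d Hd.
    apply in_rng in Hq, Hd.
    destruct (dvdb d q) eqn:E.
    + apply dvdb_iff in E; [|lia]. destruct E as [e ->]. rewrite Z.div_mul by lia.
      rewrite (lsum_single _ e).
      * replace (Z.eqb _ _) with true by (symmetry; apply Z.eqb_eq; ring). cbn; lra.
      * apply NoDup_rng.
      * apply in_rng. nia.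
      * intros m _ Hm. replace (Z.eqb _ _) with false by (symmetry; apply Z.eqb_neq; nia).
        cbn; ring.
    + apply lsum_nonneg. intros m _. pose proof (Ha d). pose proof (Hb m).
      destruct (Z.eqb _ _); cbn; nra.
  - rewrite lsum_swap. rewrite Rmult_comm, <- lsum_scal. apply lsum_le. intros d _.
    rewrite lsum_swap, Rmult_comm, <- lsum_scal. apply lsum_le. intros m _.
    rewrite lsum_scal. rewrite <- (Rmult_1_r (a d * b m)) at 2.
    apply Rmult_le_compat_l; [now apply Rmult_le_pos|].
    destruct (in_dec Z.eq_dec (d * m)%Z (rng n)) as [Hin|Hin].
    + rewrite (lsum_single _ (d * m)%Z); [rewrite Z.eqb_refl; cbn; lra|apply NoDup_rng|easy|].
      intros q _ Hq. apply Z.eqb_neq in Hq. now rewrite Hq.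
    + rewrite (lsum_ext _ _ (fun _ => 0)); [rewrite lsum_const; lra|].
      intros q Hq. replace (Z.eqb _ _) with false; [easy|]. symmetry. apply Z.eqb_neq.
      now intros ->.
Qed.

(** * The error terms *)

Lemma good_primes_admissible f Bad q :
  admissible f Bad q = true -> sqfreeb q = true /\ good_primes f Bad (pfactors q).
Proof.
  unfold admissible. rewrite !andb_true_iff, Z.eqb_eq. intros [[Hq Hg] Hf].
  pose proof (sqfreeb_pos q Hq) as Hpos. split; [easy|]. intros p Hp.
  assert (Hp' := Hp). apply in_pfactors in Hp; [|easy]. destruct Hp as [Hp Hd]. split; [easy|].
  pose proof (two_le_prime p Hp).
  unfold good_prime. apply andb_true_iff. split.
  - apply Z.eqb_eq. pose proof (Z.gcd_nonneg p Bad).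
    assert (H1 : (Z.gcd p Bad | 1)%Z).
    { rewrite <- Hg. apply Z.gcd_greatest; [|apply Z.gcd_divide_r].
      apply Z.divide_trans with p; [apply Z.gcd_divide_l|easy]. }
    now apply Z.divide_1_r_nonneg in H1.
  - destruct f; try easy. rewrite forallb_forall in Hf. now apply Hf.
Qed.

Lemma good_primes_divisor f Bad q d :
  (0 < q)%Z -> (0 < d)%Z -> (d | q)%Z ->
  good_primes f Bad (pfactors q) -> good_primes f Bad (pfactors d).
Proof.
  intros Hq Hd Hdq H p Hp. apply H. apply in_pfactors in Hp; [|easy]. apply in_pfactors; [easy|].
  split; [easy|]. apply Z.divide_trans with d; easy.
Qed.

(** Replaces X^(2 theta) by an error relative to [chi], with a constant valid for all X >= 1. *)
Lemma innerS_error G Bad Ups f delta theta :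
  is_subgroup G -> in_SL2Z G -> surjective_mod G Bad -> (2 | Bad)%Z -> theta < delta ->
  (forall X g, 0 <= Ups X g <= 1) ->
  (exists C, C > 0 /\ forall eta, eta > 0 -> exists X1, forall X, X >= X1 ->
       Rabs (UpsSum G Ups X / (C * Rpower X (2 * delta)) - 1) <= eta) ->
  (exists K, forall X, X >= 1 -> equidistributed G Bad Ups X (K * Rpower X (2 * theta))) ->
  exists K, 0 < K /\ forall X Y q, 1 <= X -> sqfreeb q = true -> good_primes f Bad (pfactors q) ->
    Rabs (innerS G Ups f q X Y - prodp q (fun p => beta_p p - rho_p p) * chi G Ups X Y)
      <= K * 3 ^ length (pfactors q) * (chi G Ups X Y / Rpower X (2 * (delta - theta))).
Proof.
  intros HG HSL Hsurj HB2 Htheta HU [C [HC Hasym]] [K0 Hequi].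
  (* Relative error 1/2 gives the sum of Ups the lower bound (C/2) X^(2 delta) for X >= X1, hence
     X^(2 theta) <= (2/C) (sum of Ups) / X^(2(delta - theta)). *)
  destruct (Hasym (1 / 2)) as [X1 HX1]; [lra|].
  (* As theta < delta, [K1] bounds X^(2(delta - theta)) for 1 <= X <= X1. *)
  set (K1 := Rpower (Rmax X1 1) (2 * (delta - theta))).
  assert (HK1 : 0 < K1) by apply exp_pos.
  assert (HC2 : 0 < 2 / C) by (apply Rdiv_lt_0_compat; lra).
  assert (HK0 : 0 <= Rabs K0 * (2 / C)) by (apply Rmult_le_pos; [apply Rabs_pos|lra]).
  (* One summand for each range of X; the absolute value because the sign of [K0] is not known. *)
  exists (Rabs K0 * (2 / C) + 2 * K1). split; [lra|]. intros X Y q HX Hq Hgood.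
  pose proof (sqfreeb_pos q Hq) as Hpos.
  set (W := Rpower X (2 * (delta - theta))). assert (HW : 0 < W) by apply exp_pos.
  set (w := 3 ^ length (pfactors q)).
  assert (Hw : 1 <= w) by (apply pow_R1_Rle; lra).
  pose proof (chi_nonneg G Ups X Y HU) as Hchi.
  assert (Hchi' : 0 <= chi G Ups X Y / W) by (apply Rle_mult_inv_pos; easy).
  destruct (Rle_lt_dec X1 X) as [H|H].
  - apply Rle_trans with (Rabs K0 * (2 / C) * w * (chi G Ups X Y / W)).
    2:{ apply Rmult_le_compat_r; [easy|]. apply Rmult_le_compat_r; lra. }
    eapply Rle_trans; [apply (innerS_equidistributed G Bad Ups f X Y _ q HG HSL Hsurj
      (Hequi X (Rle_ge _ _ HX)) HB2 Hgood)|]. fold w.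
    specialize (HX1 X (Rle_ge _ _ H)).
    set (P := Rpower X (2 * theta)). assert (HP : 0 < P) by apply exp_pos.
    assert (HPW : Rpower X (2 * delta) = P * W)
      by (unfold P, W; rewrite <- Rpower_plus; f_equal; ring).
    rewrite HPW in HX1. unfold chi. set (S := UpsSum G Ups X) in *.
    pose proof (OmegaCard_nonneg G Y) as HO. set (O := OmegaCard G Y) in *.
    assert (HS : P <= 2 / C * (S / W)).
    { assert (H1 : 1 / 2 <= S / (C * (P * W)))
        by (unfold Rabs in HX1; destruct Rcase_abs in HX1; lra).
      replace (2 / C * (S / W)) with (2 * P * (S / (C * (P * W)))) by (field; lra). nra. }
    replace (Rabs K0 * (2 / C) * w * (O * S / W))
      with (O * (w * (Rabs K0 * (2 / C * (S / W))))) by (field; lra).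
    apply Rmult_le_compat_l; [easy|]. apply Rmult_le_compat_l; [lra|].
    pose proof (Rle_abs K0). pose proof (Rabs_pos K0).
    apply Rle_trans with (Rabs K0 * P); [apply Rmult_le_compat_r; lra|].
    now apply Rmult_le_compat_l.
  - (* The asymptotics give no lower bound for chi here, so compare trivially with chi itself. *)
    apply Rle_trans with (2 * K1 * w * (chi G Ups X Y / W)).
    2:{ apply Rmult_le_compat_r; [easy|]. apply Rmult_le_compat_r; lra. }
    (* One [chi] bounds the sum itself, the other its main term, whose coefficient is at most 1/q^2
       <= 1. *)
    apply Rle_trans with (2 * chi G Ups X Y).
    + eapply Rle_trans; [apply Rabs_triang|]. rewrite Rabs_Ropp, Rabs_mult.
      rewrite (Rabs_right (chi G Ups X Y)) by lra.
      pose proof (Rabs_innerS_le G Ups f q X Y HU Hpos).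
      pose proof (Rabs_prodp_beta_rho_le q Hq) as H1.
      assert (H2 : / IZR q ^ 2 <= 1).
      { assert (1 <= IZR q) by (apply IZR_le; lia).
        rewrite <- Rinv_1. apply Rinv_le_contravar; nra. }
      nra.
    + assert (HWK : W <= K1).
      { apply Rle_Rpower_l; [lra|]. pose proof (Rmax_l X1 1). lra. }
      replace (2 * K1 * w * (chi G Ups X Y / W)) with (2 * (chi G Ups X Y / W * (K1 * w)))
        by (field; lra).
      apply Rmult_le_compat_l; [lra|].
      replace (chi G Ups X Y) with (chi G Ups X Y / W * W) at 1 by (field; lra).
      apply Rmult_le_compat_l; [easy|]. nra.
Qed.

(** Nonnegativity of the majorant allows the conditions of admissibility and q < QQ to be dropped,
    leaving a full convolution. *)
Lemma adm_sum_le f Bad QQ r a : (forall d, 0 <= a d) ->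
  (forall q, admissible f Bad q = true ->
     Rabs (r q) <= lsum (divs q) (fun d => a d * rho (q / d))) ->
  adm_sum f Bad QQ (fun q => Rabs (r q))
    <= lsum (rng (Z.to_nat (up QQ))) a * lsum (rng (Z.to_nat (up QQ))) rho.
Proof.
  intros Ha Hr. eapply Rle_trans; [|apply sum_convolution_le; [easy|apply rho_nonneg]].
  unfold adm_sum. apply (lsum_le (rng _)). intros q _.
  assert (H0 : 0 <= lsum (divs q) (fun d => a d * rho (q / d)))
    by (apply lsum_nonneg; intros; apply Rmult_le_pos; [easy|apply rho_nonneg]).
  destruct (admissible f Bad q) eqn:E; cbn [andb]; [|easy].
  destruct (Rltb (IZR q) QQ); [now apply Hr|easy].
Qed.

(** For QQ >= 1 one has up QQ <= QQ + 1 <= 2 QQ, whence the factor 2^eps. *)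
Lemma Rpower_up_le eps : 0 < eps -> forall QQ, 1 <= QQ ->
  (1 <= Z.to_nat (up QQ))%nat /\
  Rpower (INR (Z.to_nat (up QQ))) eps <= Rpower 2 eps * Rpower QQ eps.
Proof.
  intros He QQ HQ. destruct (archimed QQ) as [H1 H2].
  assert (H3 : (1 < up QQ)%Z) by (apply lt_IZR; lra). split; [lia|].
  rewrite INR_IZR_INZ, Z2Nat.id by lia. rewrite Rpower_mult_distr by lra.
  apply Rle_Rpower_l; lra.
Qed.

Lemma beta_prodp f Bad q : good_primes f Bad (pfactors q) -> beta f Bad q = prodp q beta_p.
Proof.
  intros H. apply lprod_ext. intros p Hp. destruct (H p Hp) as [_ ->]. reflexivity.
Qed.

Lemma mainM_divs G Ups f X Y Q0 qq : (0 < qq)%Z ->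
  mainM G Ups f X Y Q0 qq = lsum (divs qq) (fun q =>
    if Rltb (IZR q) Q0 then rho (qq / q) * innerS G Ups f q X Y else 0).
Proof.
  intros Hqq. unfold divs. rewrite lsum_filter. unfold mainM. apply (lsum_ext (rng _)).
  intros q _. unfold dvdb. destruct (Z.eqb _ _), (Rltb _ _); reflexivity.
Qed.

Theorem theorem6
  (G : mat -> bool) (Bad : Z) (delta theta : R) (Ups : R -> mat -> R)
  (f : form) (x y kappa : R)
  (* Gamma: finitely generated, Zariski dense, thin subgroup of SL(2,Z) without parabolics *)
  (HGsub : is_subgroup G) (HGsl : in_SL2Z G) (HGfg : fin_generated G)
  (HGzd : zariski_dense G) (HGthin : infinite_index G) (HGpar : no_parabolic G)
  (* critical exponent and spectral gap parameter *)
  (Hdelta : critical_exponent G delta) (Hdelta_half : delta > 1/2) (Htheta : theta < delta)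
  (* bad modulus *)
  (HBpos : (0 < Bad)%Z) (HB2 : (2 | Bad)%Z)
  (HBsurj : forall q : Z, sqfreeb q = true -> Z.gcd q Bad = 1%Z ->
     forall m : mat, (mdet m mod q = 1 mod q)%Z ->
       exists g, G g = true /\ mcong g m q)
  (* smoothed indicators Ups_X *)
  (HUps01 : forall X g, 0 <= Ups X g <= 1)
  (HUps1 : forall X g, mnorm g < 9/10 * X -> Ups X g = 1)
  (HUps0 : forall X g, mnorm g > 11/10 * X -> Ups X g = 0)
  (HUpsAsym : exists C, C > 0 /\ forall eta, eta > 0 -> exists X1, forall X, X >= X1 ->
       Rabs (UpsSum G Ups X / (C * Rpower X (2 * delta)) - 1) <= eta)
  (HUpsEq : exists K, forall X, X >= 1 -> forall g0, G g0 = true ->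
     forall q : Z, sqfreeb q = true -> Z.gcd q Bad = 1%Z ->
     forall H : mat -> bool, is_subgroup H -> (forall g, H g = true -> G g = true) ->
       (forall g, G g = true -> mcong g mI q -> H g = true) ->
       forall n : nat, is_index G H n ->
         (* sum_{gamma in H} Ups_X(gamma g0) = sum over the coset H g0 *)
         Rabs (ballsum (fun g => H (mmul g (minv g0))) (Ups X) (2 * X)
               - / INR n * UpsSum G Ups X) <= K * Rpower X (2 * theta))
  (* exponents: X = T^x, Y = T^y, x + y = 1, Q0 = T^kappa *)
  (Hx : 0 < x) (Hy : 0 < y) (Hxy : x + y = 1) (Hkappa : 0 < kappa) :
  exists r1 r2 : R -> Z -> R,
    (forall T, T >= 1 -> forall qq : Z, admissible f Bad qq = true ->
       mainM G Ups f (Rpower T x) (Rpower T y) (Rpower T kappa) qq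
       = beta f Bad qq * chi G Ups (Rpower T x) (Rpower T y) + r1 T qq + r2 T qq) /\
    (forall eps, eps > 0 -> exists K, forall T, T >= 1 -> forall QQ, QQ >= 1 ->
       adm_sum f Bad QQ (fun qq => Rabs (r1 T qq))
         <= K * (chi G Ups (Rpower T x) (Rpower T y) * Rpower QQ eps * Rpower T kappa
                 / Rpower (Rpower T x) (2 * (delta - theta))) /\
       adm_sum f Bad QQ (fun qq => Rabs (r2 T qq))
         <= K * (chi G Ups (Rpower T x) (Rpower T y) * Rpower QQ eps / Rpower T kappa)).
Proof.
  assert (HX : forall T, 1 <= T -> 1 <= Rpower T x) by (intros; apply Rpower_ge_1; lra).
  destruct (innerS_error G Bad Ups f delta theta HGsub HGsl HBsurj HB2 Htheta HUps01 HUpsAsym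
    HUpsEq) as [K0 [HK0 Herr]].
  set (b q := prodp q (fun p => beta_p p - rho_p p)).
  set (chi_ T := chi G Ups (Rpower T x) (Rpower T y)).
  set (W T := Rpower (Rpower T x) (2 * (delta - theta))).
  assert (Hchi : forall T, 0 <= chi_ T) by (intros; now apply chi_nonneg).
  assert (HW : forall T, 0 < W T) by (intros; apply exp_pos).
  assert (HchiW : forall T, 0 <= chi_ T / W T) by (intros; now apply Rle_mult_inv_pos).
  exists (fun T qq => lsum (divs qq) (fun q => if Rltb (IZR q) (Rpower T kappa)
    then rho (qq / q) * (innerS G Ups f q (Rpower T x) (Rpower T y) - b q * chi_ T) else 0)).
  exists (fun T qq => lsum (divs qq) (fun q => if Rltb (IZR q) (Rpower T kappa)
    then 0 else - (rho (qq / q) * (b q * chi_ T)))).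
  split.
  - intros T HT qq Hadm. apply good_primes_admissible in Hadm. destruct Hadm as [Hsq Hgood].
    pose proof (sqfreeb_pos qq Hsq) as Hpos.
    rewrite mainM_divs, (beta_prodp _ _ _ Hgood) by easy.
    replace (prodp qq beta_p) with (lsum (divs qq) (fun q => rho (qq / q) * b q)).
    + fold (chi_ T). rewrite (Rmult_comm _ (chi_ T)), <- lsum_scal, <- !lsum_plus.
      apply lsum_ext. intros q _. destruct (Rltb _ _); ring.
    + transitivity (prodp qq (fun p => rho_p p + (beta_p p - rho_p p))).
      * rewrite <- sum_divisors_prodp by easy. apply lsum_ext. intros q Hq.
        apply in_divs in Hq; [|easy]. destruct Hq as [Hq [e ->]].
        rewrite Z.div_mul by lia. rewrite rho_prodp; [easy|].
        apply (sqfreeb_divide _ _ Hsq); [nia|apply Z.divide_factor_l].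
      * apply lprod_ext. intros; ring.
  (* The bound on r1 spends eps twice, on 3^omega(q) and on the sum of rho; r2 spends it only on the
     sum of rho. *)
  - intros eps Heps. set (e := eps / 2). assert (He : 0 < e) by (unfold e; lra).
    destruct (omega_power_bound 3 e) as [K1 [HK1 Hom]]; [lra|easy|].
    destruct (sum_rho_bound e He) as [K2 [HK2 Hrho]].
    destruct (sum_rho_bound eps) as [K3 [HK3 Hrho']]; [lra|].
    assert (Hp2 : 0 < Rpower 2 eps) by apply exp_pos.
    set (C1 := K0 * K1 * K2 * Rpower 2 eps). set (C2 := 2 * K3 * Rpower 2 eps).
    assert (HC1 : 0 < C1) by (unfold C1; repeat apply Rmult_lt_0_compat; easy).
    assert (HC2 : 0 < C2) by (unfold C2; repeat apply Rmult_lt_0_compat; lra).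
    exists (C1 + C2). intros T HT QQ HQQ.
    set (Q0 := Rpower T kappa). assert (HQ0 : 1 <= Q0) by (apply Rpower_ge_1; lra).
    fold (chi_ T) (W T).
    destruct (Rpower_up_le eps ltac:(lra) QQ ltac:(lra)) as [HN HNe].
    set (N := Z.to_nat (up QQ)) in *.
    assert (HN1 : 1 <= INR N) by (apply (le_INR 1); easy).
    assert (HQe : 0 < Rpower QQ eps) by apply exp_pos.
    assert (HNpos : 0 < Rpower (INR N) e) by apply exp_pos.
    assert (HNN : Rpower (INR N) e * Rpower (INR N) e = Rpower (INR N) eps)
      by (rewrite <- Rpower_plus; f_equal; unfold e; lra).
    specialize (HchiW T). specialize (Hchi T). specialize (HW T).
    split.
    (* The majorant is summed over every q <= N, so the squarefree test is built in for the bound on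
       3^omega(q) to apply. *)
    + set (a q := if Rltb (IZR q) Q0 && sqfreeb q
        then K0 * 3 ^ length (pfactors q) * (chi_ T / W T) else 0).
      assert (Ha : forall q, 0 <= a q).
      { intros q. unfold a. destruct (_ && _); [|lra]. apply Rmult_le_pos; [|easy].
        apply Rmult_le_pos; [lra|]. apply pow_le; lra. }
      eapply Rle_trans; [apply (adm_sum_le f Bad QQ _ a Ha)|].
      * intros qq Hadm. apply good_primes_admissible in Hadm. destruct Hadm as [Hsq Hgood].
        pose proof (sqfreeb_pos qq Hsq) as Hpos.
        eapply Rle_trans; [apply lsum_abs|]. apply lsum_le. intros q Hq.
        apply in_divs in Hq; [|easy]. destruct Hq as [Hq Hqq].
        assert (Hsqq : sqfreeb q = true) by (apply (sqfreeb_divide qq); easy).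
        unfold a. rewrite Hsqq, andb_true_r. fold Q0. destruct (Rltb (IZR q) Q0).
        -- rewrite Rabs_mult, (Rabs_right (rho _)) by (apply Rle_ge, rho_nonneg).
           rewrite Rmult_comm. apply Rmult_le_compat_r; [apply rho_nonneg|].
           apply Herr; [apply HX; lra|easy|].
           now apply (good_primes_divisor f Bad qq).
        -- rewrite Rabs_R0. lra.
      * fold N.
        (* With 3^omega(q) <= K1 N^e uniformly, only the number of q < Q0 is left. *)
        assert (HA : lsum (rng N) a <= K0 * K1 * (chi_ T / W T) * Rpower (INR N) e * Q0).
        { eapply Rle_trans; [|apply Rmult_le_compat_l; [|apply (count_lt_bound N); lra]].
          2:{ repeat (apply Rmult_le_pos; try lra). }
          rewrite <- lsum_scal. apply lsum_le. intros q Hq. apply in_rng in Hq. unfold a.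
          destruct (Rltb (IZR q) Q0); cbn [andb ind]; [|lra].
          assert (0 <= K0 * (chi_ T / W T)) by (apply Rmult_le_pos; lra).
          destruct (sqfreeb q) eqn:Eq.
          - replace (K0 * 3 ^ length (pfactors q) * (chi_ T / W T))
              with (K0 * (chi_ T / W T) * 3 ^ length (pfactors q)) by ring.
            replace (K0 * K1 * (chi_ T / W T) * Rpower (INR N) e * 1)
              with (K0 * (chi_ T / W T) * (K1 * Rpower (INR N) e)) by ring.
            apply Rmult_le_compat_l; [easy|].
            eapply Rle_trans; [now apply Hom|]. apply Rmult_le_compat_l; [lra|].
            apply Rle_Rpower_l; [lra|]. rewrite INR_IZR_INZ.
            split; [apply IZR_lt|apply IZR_le]; lia.
          - rewrite Rmult_1_r. repeat (apply Rmult_le_pos; try lra). }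
        specialize (Hrho N HN).
        apply Rle_trans with (K0 * K1 * (chi_ T / W T) * Rpower (INR N) e * Q0
          * (K2 * Rpower (INR N) e)).
        { apply Rmult_le_compat; try easy; apply lsum_nonneg; intros; [easy|apply rho_nonneg]. }
        replace (K0 * K1 * (chi_ T / W T) * Rpower (INR N) e * Q0 * (K2 * Rpower (INR N) e))
          with (K0 * K1 * K2 * (chi_ T / W T) * Q0 * (Rpower (INR N) e * Rpower (INR N) e)) by ring.
        rewrite HNN.
        apply Rle_trans with (C1 * (chi_ T * Rpower QQ eps * Q0 / W T)).
        -- unfold C1. replace (K0 * K1 * K2 * Rpower 2 eps * (chi_ T * Rpower QQ eps * Q0 / W T))
             with (K0 * K1 * K2 * (chi_ T / W T) * Q0 * (Rpower 2 eps * Rpower QQ eps)) by (field; lra).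
           apply Rmult_le_compat_l; [|easy]. repeat (apply Rmult_le_pos; try lra).
        -- apply Rmult_le_compat_r; [|lra]. apply Rle_mult_inv_pos; [|easy].
           repeat (apply Rmult_le_pos; try lra).
    (* Past the truncation |b q| <= 1/q^2 is all that is used, so the sum over q is a tail of
       inverse squares. *)
    + set (a q := if Rltb (IZR q) Q0 then 0 else chi_ T * / IZR q ^ 2).
      assert (Ha : forall q, 0 <= a q).
      { intros q. unfold a. destruct (Rltb (IZR q) Q0) eqn:E; [lra|]. apply Rltb_false in E.
        apply Rle_mult_inv_pos; nra. }
      eapply Rle_trans; [apply (adm_sum_le f Bad QQ _ a Ha)|].
      * intros qq Hadm. apply good_primes_admissible in Hadm. destruct Hadm as [Hsq Hgood].
        pose proof (sqfreeb_pos qq Hsq) as Hpos.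
        eapply Rle_trans; [apply lsum_abs|]. apply lsum_le. intros q Hq.
        apply in_divs in Hq; [|easy]. destruct Hq as [Hq Hqq].
        assert (Hsqq : sqfreeb q = true) by (apply (sqfreeb_divide qq); easy).
        unfold a. fold Q0. destruct (Rltb (IZR q) Q0).
        -- rewrite Rabs_R0. lra.
        -- rewrite Rabs_Ropp, !Rabs_mult, (Rabs_right (rho _)) by (apply Rle_ge, rho_nonneg).
           rewrite Rmult_comm. apply Rmult_le_compat_r; [apply rho_nonneg|].
           rewrite (Rabs_right (chi_ T)), Rmult_comm by lra.
           apply Rmult_le_compat_l; [easy|]. now apply Rabs_prodp_beta_rho_le.
      * fold N.
        assert (HA : lsum (rng N) a <= chi_ T * (2 / Q0)).
        { eapply Rle_trans; [|apply Rmult_le_compat_l, (inverse_squares_tail N Q0 HQ0); easy].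
          rewrite <- lsum_scal. apply lsum_le. intros q _. unfold a.
          destruct (Rltb _ _); lra. }
        specialize (Hrho' N HN).
        apply Rle_trans with (chi_ T * (2 / Q0) * (K3 * Rpower (INR N) eps)).
        { apply Rmult_le_compat; try easy; apply lsum_nonneg; intros; [easy|apply rho_nonneg]. }
        assert (H0 : 0 <= chi_ T / Q0) by (apply Rle_mult_inv_pos; lra).
        apply Rle_trans with (C2 * (chi_ T * Rpower QQ eps / Q0)).
        -- unfold C2. replace (2 * K3 * Rpower 2 eps * (chi_ T * Rpower QQ eps / Q0))
             with (chi_ T / Q0 * (2 * K3) * (Rpower 2 eps * Rpower QQ eps)) by (field; lra).
           replace (chi_ T * (2 / Q0) * (K3 * Rpower (INR N) eps))
             with (chi_ T / Q0 * (2 * K3) * Rpower (INR N) eps) by (field; lra).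
           apply Rmult_le_compat_l; [|easy]. repeat (apply Rmult_le_pos; try lra).
        -- apply Rmult_le_compat_r; [|lra]. apply Rle_mult_inv_pos; [|lra].
           repeat (apply Rmult_le_pos; try lra).
Qed.
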